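(* For $d\in\{2,3\}$ and an integer $c\in(-d,d)$, let $S_{d,c}$ be the set consisting of all primes $p\equiv c\pmod d$ and all powers of $d$. Let $m_{d,c}(n)$ be the least positive integer $m$ for which the integers $2r(d)k(dk-c)$ $(k=1,\ldots,n)$ are pairwise distinct modulo $m$, where $r(d)$ is the radical of $d$ (so $r(2)=2$ and $r(3)=3$). Then $$m_{2,1}(n)=\min\{a\geq 4n-1:\ a\in S_{2,1}\}\quad\text{for all integers } n\geq 5,$$ $$m_{2,-1}(n)=\min\{a\geq 4n:\ a\in S_{2,-1}\}\quad\text{for all integers } n\geq 7,$$ $$m_{3,1}(n)=\min\{a\geq 3n:\ a\in S_{3,1}\}\quad\text{for all integers } n\geq 4,$$ $$m_{3,-1}(n)=\min\{a\geq 3n:\ a\in S_{3,-1}\}\quad\text{for all integers } n\geq 5,$$ $$m_{3,2}(n)=\min\{a\geq 3n-1:\ a\in S_{3,2}\}\quad\text{for all integers } n\geq 3,$$ $$m_{3,-2}(n)=\min\{a\geq 3n:\ a\in S_{3,-2}\}\quad\text{for all integers } n\geq 8.$$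
   Context: The radical $r(d)$ of a positive integer $d$ is the product of all the distinct prime divisors of $d$. The integer $c$ may be negative; $c\in(-d,d)$ means $-d<c<d$. *)

(* Defs.v *)
From mathcomp Require Import all_boot all_order all_algebra.
Set Implicit Arguments.
Unset Strict Implicit.
Unset Printing Implicit Defensive.
Import Order.TTheory GRing.Theory Num.Theory.
Local Open Scope ring_scope.

Definition radical (d : nat) : nat := (\prod_(p <- primes d) p)%N.

Definition term (d : nat) (c : int) (k : nat) : int :=
  2 * (radical d)%:Z * k%:Z * (d%:Z * k%:Z - c).

Definition distinct_mod (d : nat) (c : int) (n m : nat) : bool :=
  (0 < m)%N && uniq [seq (term d c k %% m%:Z)%Z | k <- iota 1 n].

Lemma radical_gt0 (d : nat) : (0 < radical d)%N.
Proof.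
rewrite /radical big_seq_cond; apply: (big_ind (fun x => 0 < x)%N) => //.
  by move=> x y x0 y0; rewrite muln_gt0 x0.
by move=> p; rewrite andbT mem_primes => /andP[/prime_gt0].
Qed.

Lemma term_lt (d : nat) (c : int) (i j : nat) :
  - d%:Z < c < d%:Z -> (0 < i < j)%N -> 0 <= term d c i < term d c j.
Proof.
move=> /andP[dc cd] /andP[i0 ij].
have r0 : 0 < 2 * (radical d)%:Z :> int by rewrite mulr_gt0 // ltz_nat radical_gt0.
have d0 : (0 < d)%N by have := lt_trans dc cd; case: (d).
have ci : 0 < d%:Z * i%:Z - c.
  by rewrite subr_gt0 (lt_le_trans cd) // -PoszM lez_nat leq_pmulr.
rewrite /term -!(mulrA (2 * _)) mulr_ge0 ?(ltW r0) //=; last first.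
  by rewrite mulr_ge0 // ltW.
rewrite ltr_pM2l // ltr_pM ?(ltW ci) // ?ltz_nat //.
by rewrite ltrD2r -!PoszM ltz_nat ltn_pmul2l.
Qed.

Lemma distinct_mod_ex (d : nat) (c : int) (n : nat) :
  - d%:Z < c < d%:Z -> exists m, distinct_mod d c n m.
Proof.
move=> dc; exists (absz (term d c n.+1)).
have lt_n i : (0 < i <= n)%N -> 0 <= term d c i < term d c n.+1.
  by move=> h; apply: term_lt.
have T0 : 0 < term d c n.+1.
  case: n lt_n => [|n] lt_n.
    have /andP[dcl cd] := dc; rewrite /term !mulr1.
    by rewrite mulr_gt0 ?subr_gt0 // mulr_gt0 // ltz_nat radical_gt0.
  by have /andP[h1 h2] := lt_n 1%N isT; apply: le_lt_trans h2.
rewrite /distinct_mod absz_gt0 gt_eqF //= gtz0_abs //.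
rewrite map_inj_in_uniq ?iota_uniq // => i j.
rewrite !mem_iota !add1n !ltnS => hi hj.
rewrite !modz_small ?lt_n // => eq_ij.
case: (ltngtP i j) => // lt_ij.
- have := @term_lt d c i j dc; rewrite eq_ij ltxx andbF lt_ij.
  by case/andP: hi => -> _ /(_ isT).
- have := @term_lt d c j i dc; rewrite eq_ij ltxx andbF lt_ij.
  by case/andP: hj => -> _ /(_ isT).
Qed.

(* m_{d,c}(n); the hypothesis on c only serves to guarantee that some modulus
   discriminates the first n terms. *)
Definition least_modulus (d : nat) (c : int) (dc : - d%:Z < c < d%:Z)
    (n : nat) : nat :=
  ex_minn (distinct_mod_ex n dc).

Definition in_S (d : nat) (c : int) (a : nat) : Prop :=
  (prime a /\ (a%:Z = c %[mod d%:Z])%Z) \/ exists k : nat, a = (d ^ k)%N.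

Definition is_least (P : nat -> Prop) (a : nat) : Prop :=
  P a /\ forall b : nat, P b -> (a <= b)%N.

(* Main.v *)
(* Two of the first n terms agree modulo m exactly when m divides
   2 r(d) (k - l) (d (k + l) - c) for some 1 <= l < k <= n.  If m is a power of d
   or a prime congruent to c, and m is at least the stated bound, then neither
   factor is large enough.  Conversely, if m is smaller than the next element of
   S_{d,c} and does not belong to the relevant part of S_{d,c}, then writing m as a
   product g b (or using m itself when m is a prime in the wrong class) one solves
   g | k - l and b | d (k + l) - c within the range.  This needs the next element
   of S_{d,c} to be at most 8n for d = 2, where a power of 2 does, and at most
   6n - 5 for d = 3, since a prime m congruent to -c modulo 3 can only collide
   through 3 (k + l) - c = m.

   For d = 3 we thus need Bertrand's postulate in both classes modulo 6, by the
   method of Erdos: for a = 1 or 5 the product of the 6 j + a (j < n), divided by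
   the part of n! coprime to 6, is an integer of size about 432^(n/2); its prime
   factors p beyond sqrt(6n) occur once, and those outside the class a
   satisfy 5 p <= 6 n. *)
From Stdlib Require Import PeanoNat NArith Lia.
Require Import Defs.
From mathcomp Require Import all_boot all_order all_algebra.
From mathcomp Require Import zify ring.
Set Implicit Arguments.
Unset Strict Implicit.
Unset Printing Implicit Defensive.
Local Open Scope nat_scope.

(** * Valuations of factorials *)

Lemma logn_prod (I : Type) (r : seq I) (P : pred I) (F : I -> nat) (p : nat) :
  (forall i, P i -> 0 < F i) ->
  logn p (\prod_(i <- r | P i) F i) = \sum_(i <- r | P i) logn p (F i).
Proof.
move=> F0.
suff [] : 0 < \prod_(i <- r | P i) F i /\
  logn p (\prod_(i <- r | P i) F i) = \sum_(i <- r | P i) logn p (F i) by [].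
apply: (big_rec2 (fun x y => 0 < x /\ logn p x = y)) => [|i x y Pi [x0 <-]].
  by rewrite logn1.
by rewrite muln_gt0 F0 // x0 lognM // F0.
Qed.

Lemma logn_count_widen (p n E : nat) : prime p -> 0 < n -> n <= E ->
  logn p n = \sum_(1 <= k < E) (p ^ k %| n).
Proof.
move=> pp n0 nE; rewrite logn_count_dvd // (big_cat_nat (n := n) _ nE) //=.
rewrite [X in _ + X]big_nat_cond [X in _ + X]big1 ?addn0 // => k.
rewrite andbT => /andP[nk _].
by rewrite gtnNdvd // (leq_ltn_trans nk) // ltn_expl // prime_gt1.
Qed.

Lemma logn_fact_widen (p n E : nat) : prime p -> n < E ->
  logn p n`! = \sum_(1 <= k < E) n %/ p ^ k.
Proof.
move=> pp nE; rewrite logn_fact // (big_cat_nat (n := n.+1) _ nE) //=.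
rewrite [X in _ + X]big_nat_cond [X in _ + X]big1 ?addn0 // => k.
rewrite andbT => /andP[nk _].
by rewrite divn_small // (leq_ltn_trans (ltnW nk)) // ltn_expl // prime_gt1.
Qed.

Lemma logn_fact_divn (p n : nat) : prime p ->
  logn p n`! = n %/ p + logn p (n %/ p)`!.
Proof.
move=> pp; rewrite (logn_fact_widen (E := n.+2)) // big_ltn // expn1; congr addn.
rewrite (logn_fact_widen (E := n.+1)) //; last by rewrite ltnS leq_div.
rewrite big_add1 /=; apply: eq_bigr => k _.
by rewrite expnS divnMA.
Qed.

(** By Legendre the valuation is [n] minus the binary digit sum of [n], and 2 to the digit sum is at
    most [n + 1]. The induction strips the last digit. *)
Lemma pow2_logn_fact (n : nat) : 2 ^ n <= 2 ^ logn 2 n`! * n.+1.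
Proof.
elim/ltn_ind: n => -[//|n] IH; rewrite logn_fact_divn // expnD.
set N := n.+1; have := IH (N %/ 2) _; rewrite /N ltn_Pdiv // => /(_ isT).
rewrite -/N; have: N %% 2 < 2 by rewrite ltn_mod.
have := divn_eq N 2; clear IH.
set m := N %/ 2; set r := N %% 2; set v := 2 ^ logn 2 m`! => Ne r2 IHm.
clearbody v r m; rewrite {}Ne.
rewrite !expnD; have -> : 2 ^ (m * 2) = 2 ^ m * 2 ^ m by rewrite -expnD addnn -muln2.
have e0 : 0 < 2 ^ m by rewrite expn_gt0.
rewrite -!mulnA leq_mul2l; apply/orP; right.
by case: r r2 => [|[|//]] _; rewrite ?expn0 ?expn1; nia.
Qed.

(** Here the valuation is half of [n] minus the ternary digit sum. Base 9 absorbs the half, and 3 to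
    the digit sum is at most the square of [n + 1]. *)
Lemma pow3_logn_fact (n : nat) : 3 ^ n <= 9 ^ logn 3 n`! * n.+1 ^ 2.
Proof.
elim/ltn_ind: n => -[//|n] IH; rewrite logn_fact_divn // expnD.
set N := n.+1; have := IH (N %/ 3) _; rewrite /N ltn_Pdiv // => /(_ isT).
rewrite -/N; have: N %% 3 < 3 by rewrite ltn_mod.
have := divn_eq N 3; clear IH.
set m := N %/ 3; set r := N %% 3; set v := 9 ^ logn 3 m`! => Ne r2 IHm.
clearbody v r m; rewrite {}Ne.
rewrite !expnD; have -> : 3 ^ (m * 3) = 9 ^ m * 3 ^ m.
  by rewrite mulnC expnM -expnMn.
rewrite -!mulnA leq_mul2l; apply/orP; right; move: IHm; rewrite -!mulnn.
by case: r r2 => [|[|[|//]]] _; rewrite ?expn0 ?expn1 ?muln1; nia.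
Qed.

Lemma logn3_fact_le (n : nat) : (logn 3 n`!).*2 <= n.
Proof.
elim/ltn_ind: n => -[//|n] IH; rewrite logn_fact_divn //.
have := IH (n.+1 %/ 3) _; rewrite ltn_Pdiv // => /(_ isT).
by lia.
Qed.

Lemma logn2_fact_le (n : nat) : logn 2 n`! <= n.
Proof.
elim/ltn_ind: n => -[//|n] IH; rewrite logn_fact_divn //.
have := IH (n.+1 %/ 2) _; rewrite ltn_Pdiv // => /(_ isT).
by lia.
Qed.

(** * The Chebyshev quotient of a class modulo 6 *)

Lemma dvd_affine (q k r : nat) : 0 < q -> coprime q k ->
  exists2 x, x < q & q %| k * x + r.
Proof.
move=> q0 qk; have [y ye] : exists y, k * y = 1 %[mod q].
  have [k0|k0] := posnP k.
    by exists 0; move: qk; rewrite k0 /coprime gcdn0 => /eqP->; rewrite !modn1.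
  have /eqP g : coprime k q by rewrite coprime_sym.
  have [km kn e _] := @egcdnP k q k0.
  by exists km; rewrite mulnC e g modnMDl.
exists ((y * (q - r %% q)) %% q); first by rewrite ltn_mod.
rewrite /dvdn -modnDml modnMmr mulnA -modnMml ye modnMml mul1n modnDml.
by rewrite -modnDmr subnK ?modnn // ltnW // ltn_mod.
Qed.

Definition progression_prod (a n : nat) : nat := \prod_(0 <= j < n) (6 * j + a).

(** As 6 is invertible modulo [q], the solutions [j] form one class [j0 + q * i] with [j0 < q];
    hence [r = q - 1 - j0]. *)
Lemma count_dvd_progression (q a n : nat) : coprime q 6 -> 1 < q ->
  exists2 r, r < q &
    \sum_(0 <= j < n) (q %| 6 * j + a) = (n + r) %/ q.
Proof.
move=> q6 q1; have q0 : 0 < q by apply: ltnW.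
have [j0 j0q dj0] := dvd_affine a q0 q6.
exists (q.-1 - j0); first by lia.
elim: n => [|n IH]; first by rewrite big_nil divn_small //; lia.
rewrite big_nat_recr //= IH addSn divnS // addnC; congr (nat_of_bool _ + _).
have -> : (n + (q.-1 - j0)).+1 = n + q - j0 by lia.
have e : 6 * n + a + 6 * q = 6 * (n + q - j0) + (6 * j0 + a) by lia.
rewrite -[LHS](dvdn_addl _ (dvdn_mull 6 (dvdnn q))) e.
by rewrite (dvdn_addl _ dj0) Gauss_dvdr.
Qed.

Lemma dvdn_logn (m x : nat) : 0 < m -> 0 < x ->
  (forall p, prime p -> logn p m <= logn p x) -> m %| x.
Proof.
move=> m0 x0 le_log; apply/dvdn_partP => // p; rewrite mem_primes => /andP[pp _].
by rewrite p_part pfactor_dvdn // le_log.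
Qed.

Lemma prod_pfactor (x M : nat) : 0 < x ->
  (forall p, prime p -> M <= p -> logn p x = 0) ->
  x = \prod_(0 <= p < M | prime p) p ^ logn p x.
Proof.
move=> x0 logM; rewrite -{1}(partnT x0) (widen_partn (m := x + M)) ?leq_addr //.
have le_M : M <= (x + M).+1 by lia.
rewrite (big_cat_nat (n := M) _ le_M) //= [X in _ * X]big_nat_cond [X in _ * X]big1.
  rewrite muln1 [RHS]big_mkcond; apply: eq_bigr => p _ /=.
  by case: ifP => // np; rewrite lognE np.
move=> p; rewrite andbT => /andP[Mp _].
by have [/logM->|np] := boolP (prime p); rewrite // lognE (negPf np).
Qed.

(** The powers of 2 and 3 cancel those of the factorial, leaving its part coprime to 6. For [a]
    equal to 1 or 5 the division is exact, by [fact_dvd_progression]. *)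
Definition chebyshev_quot (a n : nat) : nat :=
  (progression_prod a n * (2 ^ logn 2 n`! * 3 ^ logn 3 n`!)) %/ n`!.

Lemma progression_prod_gt0 (a n : nat) : 0 < a -> 0 < progression_prod a n.
Proof. by move=> a0; apply: prodn_gt0 => j; rewrite addn_gt0 a0 orbT. Qed.

Lemma coprime6 (p : nat) : prime p -> 3 < p -> coprime p 6.
Proof.
move=> pp p3; rewrite prime_coprime //; apply/negP => p6; have := dvdn_leq (isT : 0 < 6) p6.
by case: p p6 p3 pp => [|[|[|[|[|[|[|p]]]]]]].
Qed.

Lemma count_dvd_ge (q a n : nat) : coprime q 6 -> 1 < q ->
  n %/ q <= \sum_(0 <= j < n) (q %| 6 * j + a).
Proof.
move=> q6 q1; have [r _ ->] := count_dvd_progression a n q6 q1.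
by rewrite leq_div2r // leq_addr.
Qed.

Lemma count_dvd_le (q a n : nat) : coprime q 6 -> 1 < q -> 0 < a < 6 ->
  \sum_(0 <= j < n) (q %| 6 * j + a) <= n %/ q + (q <= 6 * n).
Proof.
move=> q6 q1 /andP[a0 a6]; have [q6n|nq] := leqP q (6 * n).
  have [r rq ->] := count_dvd_progression a n q6 q1.
  have -> : n %/ q + 1 = (n + q) %/ q by rewrite divnDr // divnn ltnW.
  by rewrite leq_div2r // leq_add2l ltnW.
rewrite big_nat_cond big1 // => j; rewrite andbT => /andP[_ jn].
by rewrite gtnNdvd //; lia.
Qed.

Section Valuations.

Variables (a n : nat).
Hypotheses (a6 : coprime a 6) (lt_a6 : a < 6).

Let a0 : 0 < a. Proof. by case: a a6. Qed.

Lemma logn_progression_prod (p : nat) : prime p ->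
  logn p (progression_prod a n) =
  \sum_(1 <= k < 6 * n + 1) \sum_(0 <= j < n) (p ^ k %| 6 * j + a).
Proof.
move=> pp; rewrite logn_prod; last by move=> j _; rewrite addn_gt0 a0 orbT.
rewrite exchange_big /= big_nat_cond [RHS]big_nat_cond.
apply: eq_bigr => j; rewrite andbT => /andP[_ jn].
by rewrite (logn_count_widen (E := 6 * n + 1)) //; lia.
Qed.

Lemma logn_fact_le_progression (p : nat) : prime p -> 3 < p ->
  logn p n`! <= logn p (progression_prod a n).
Proof.
move=> pp p3; rewrite logn_progression_prod //.
rewrite (logn_fact_widen (E := 6 * n + 1)) //; last by lia.
rewrite big_nat_cond [leqRHS]big_nat_cond; apply: leq_sum => k.
rewrite andbT => /andP[k0 _]; apply: count_dvd_ge.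
  by rewrite coprimeXl // coprime6.
by rewrite (leq_trans (prime_gt1 pp)) // -{1}(expn1 p) leq_pexp2l // prime_gt0.
Qed.

(** For each [k] with [p ^ k <= 6 * n] the progression has at most one more multiple of [p ^ k] than
    the interval from 1 to [n]; larger [k] contribute nothing. *)
Lemma logn_progression_le (p : nat) : prime p -> 3 < p ->
  logn p (progression_prod a n) <= logn p n`! + trunc_log p (6 * n).
Proof.
move=> pp p3; rewrite logn_progression_prod //.
rewrite (logn_fact_widen (E := 6 * n + 1)) //; last by lia.
apply: (@leq_trans (\sum_(1 <= k < 6 * n + 1) (n %/ p ^ k + (p ^ k <= 6 * n)))).
  rewrite big_nat_cond [leqRHS]big_nat_cond; apply: leq_sum => k.
  rewrite andbT => /andP[k0 _]; apply: count_dvd_le; last by rewrite a0.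
    by rewrite coprimeXl // coprime6.
  by rewrite (leq_trans (prime_gt1 pp)) // -{1}(expn1 p) leq_pexp2l // prime_gt0.
rewrite big_split leq_add2l /=; set T := trunc_log p (6 * n).
apply: (@leq_trans (\sum_(1 <= k < 6 * n + 1) (k <= T))).
  apply: leq_sum => k _; case: (leqP (p ^ k) (6 * n)) => // h.
  by rewrite trunc_log_max // prime_gt1.
suff H M : \sum_(1 <= k < M.+1) (k <= T) <= minn M T.
  by rewrite addn1 (leq_trans (H _)) // geq_minr.
elim: M => [|M IH]; first by rewrite big_geq.
rewrite big_nat_recr //= (leq_trans (leq_add IH (leqnn _))) //.
by case: (leqP M.+1 T); lia.
Qed.

Lemma fact_dvd_progression :
  n`! %| progression_prod a n * (2 ^ logn 2 n`! * 3 ^ logn 3 n`!).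
Proof.
have A0 := progression_prod_gt0 n a0.
apply: dvdn_logn; rewrite ?fact_gt0 // ?muln_gt0 ?A0 ?expn_gt0 // => p pp.
rewrite !lognM ?muln_gt0 ?expn_gt0 // !lognX (@logn_prime p 2) // (@logn_prime p 3) //.
case: (ltnP 3 p) => [p3|]; first by rewrite (leq_trans (logn_fact_le_progression pp p3)) ?leq_addr.
by move: pp; case: p => [|[|[|[|]]]] // _ _; rewrite ?muln1 ?muln0; lia.
Qed.

Lemma chebyshev_quotE :
  chebyshev_quot a n * n`! =
  progression_prod a n * (2 ^ logn 2 n`! * 3 ^ logn 3 n`!).
Proof. by rewrite divnK // fact_dvd_progression. Qed.

Lemma chebyshev_quot_gt0 : 0 < chebyshev_quot a n.
Proof.
have A0 := progression_prod_gt0 n a0.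
have: 0 < chebyshev_quot a n * n`! by rewrite chebyshev_quotE ?muln_gt0 ?A0 ?expn_gt0.
by rewrite muln_gt0 => /andP[].
Qed.

Lemma logn_chebyshev_quot (p : nat) : prime p -> 3 < p ->
  logn p (chebyshev_quot a n) = logn p (progression_prod a n) - logn p n`!.
Proof.
move=> pp p3; have A0 := progression_prod_gt0 n a0.
rewrite logn_div ?fact_dvd_progression // !lognM ?muln_gt0 ?expn_gt0 //.
rewrite !lognX (@logn_prime p 2) // (@logn_prime p 3) //.
have [-> ->] : (p == 2) = false /\ (p == 3) = false by lia.
by rewrite !muln0 !addn0.
Qed.

(** The progression is coprime to 6, and the adjoined powers cancel exactly the powers of 2 and 3 in
    the factorial. *)
Lemma logn_chebyshev_quot_small (p : nat) : prime p -> p <= 3 ->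
  logn p (chebyshev_quot a n) = 0.
Proof.
move=> pp p3; have A0 := progression_prod_gt0 n a0.
have p6 : p %| 6 by case: p pp p3 => [|[|[|[|]]]].
have lA : logn p (progression_prod a n) = 0.
  rewrite logn_prod; last by move=> j _; rewrite addn_gt0 a0 orbT.
  apply: big1 => j _; apply/eqP; rewrite -leqn0 leqNgt logn_gt0 mem_primes.
  rewrite pp addn_gt0 a0 orbT /=; apply/negP => d.
  have: p %| gcdn a 6 by rewrite dvdn_gcd p6 -(dvdn_addr _ (dvdn_mulr j p6)) d.
  by rewrite (eqP a6) dvdn1 => /eqP p1; rewrite p1 in pp.
rewrite logn_div ?fact_dvd_progression // !lognM ?muln_gt0 ?expn_gt0 //.
rewrite lA !lognX (@logn_prime p 2) // (@logn_prime p 3) //.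
by move: pp; case: p p3 {lA p6} => [|[|[|[|]]]] // _ _; rewrite ?muln1 ?muln0; lia.
Qed.

Lemma logn_chebyshev_quot_le (p : nat) : prime p ->
  logn p (chebyshev_quot a n) <= trunc_log p (6 * n).
Proof.
move=> pp; have [p3|p3] := leqP p 3; first by rewrite logn_chebyshev_quot_small.
by rewrite logn_chebyshev_quot // leq_subLR logn_progression_le.
Qed.

(** Such a prime is itself a factor [6 * j + a], and it is too large to divide the factorial. *)
Lemma logn_chebyshev_quot_ge (p : nat) : prime p -> p %% 6 = a ->
  n < p -> p < 6 * n -> 0 < logn p (chebyshev_quot a n).
Proof.
move=> pp pa np p6n; have [p3|p3] := leqP p 3.
  by move: a6 pp; rewrite -pa; case: p p3 {pa np p6n} => [|[|[|[|]]]].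
rewrite logn_chebyshev_quot // subn_gt0 (logn_fact_widen (E := n.+1)) //.
rewrite big_nat_cond big1; last first.
  move=> k; rewrite andbT => /andP[k0 _]; rewrite divn_small //.
  by rewrite (leq_trans np) // -{1}(expn1 p) leq_pexp2l // prime_gt0.
rewrite logn_gt0 mem_primes pp progression_prod_gt0 //=.
have jn : p %/ 6 < n by lia.
rewrite /progression_prod big_mkord (bigD1 (Ordinal jn)) //= dvdn_mulr //.
by have -> : 6 * (p %/ 6) + a = p by lia.
Qed.

(* If [6 * j + a = p * h] with [p] outside the class [a], then [h] is coprime
   to 6 and different from 1, whence [h >= 5]. *)
Lemma logn_chebyshev_quot_other (p : nat) : prime p -> p %% 6 != a ->
  6 * n <= 5 * p -> logn p (chebyshev_quot a n) = 0.
Proof.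
move=> pp pa np; have [p3|p3] := leqP p 3; first by rewrite logn_chebyshev_quot_small.
rewrite logn_chebyshev_quot // logn_prod; last by move=> j _; rewrite addn_gt0 a0 orbT.
rewrite big_nat_cond big1 // => j; rewrite andbT => /andP[_ jn].
apply/eqP; rewrite -leqn0 leqNgt logn_gt0 mem_primes.
rewrite pp addn_gt0 a0 orbT /=; apply/negP => /dvdnP[h e].
have h5 : h < 5.
  rewrite ltnNge; apply/negP => h5.
  have: 5 * p <= h * p by rewrite leq_mul2r h5 orbT.
  by move: lt_a6; lia.
have p6 := coprime6 pp p3.
have: coprime (6 * j + a) 6 by rewrite /coprime mulnC gcdnC gcdnMDl gcdnC.
rewrite e coprimeMl p6 andbT.
move: h5 e pa; case: h => [|[|[|[|[|]]]]] // _; rewrite mul1n => <-.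
by rewrite (mulnC 6) modnMDl modn_small // eqxx.
Qed.

End Valuations.

Lemma progression_prod_le (a n : nat) : a < 6 -> progression_prod a n <= 6 ^ n * n`!.
Proof.
move=> a6; elim: n => [|n IH]; first by rewrite /progression_prod big_geq.
rewrite /progression_prod big_nat_recr //= -/(progression_prod a n) factS expnSr.
by apply: (leq_trans (leq_mul IH (_ : 6 * n + a <= 6 * n.+1))); lia.
Qed.

(** The factors with [j > 0] are at least [6 * j] and the first is at least 1, so only the factor
    [6 * n] is lost. *)
Lemma progression_prod_ge (a n : nat) : 0 < a -> 0 < n ->
  6 ^ n * n`! <= 6 * n * progression_prod a n.
Proof.
move=> a0; case: n => // n _; elim: n => [|n IH].
  by rewrite /progression_prod big_nat1 expn1 !muln1 muln0 add0n leq_pmulr.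
rewrite /progression_prod big_nat_recr //= -/(progression_prod a n.+1) factS expnSr.
have := leq_mul (leqnn (6 * n.+2)) IH; move: (progression_prod _ _) => A h.
have := leq_mul (leqnn (6 * n.+2 * A)) (_ : 6 * n.+1 <= 6 * n.+1 + a).
by move=> /(_ (leq_addr _ _)); lia.
Qed.

(** * Primorials of a residue class modulo 6 *)

Definition class_primorial (a N : nat) : nat :=
  \prod_(0 <= p < N.+1 | prime p && (p %% 6 == a)) p.

Lemma class_primorial_widen (a N M : nat) : N < M ->
  class_primorial a N =
  \prod_(0 <= p < M) (if [&& prime p, p %% 6 == a & p <= N] then p else 1).
Proof.
move=> NM; rewrite (big_cat_nat (n := N.+1) _ NM) //=.
rewrite [X in _ * X]big_nat_cond [X in _ * X]big1 ?muln1; last first.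
  by move=> p; rewrite andbT => /andP[Np _]; rewrite leqNgt Np !andbF.
rewrite /class_primorial big_mkcond big_nat_cond [RHS]big_nat_cond.
apply: eq_bigr => p; rewrite andbT => /andP[_ pN].
by rewrite ltnS in pN; rewrite pN andbT.
Qed.

Section Bounds.

Variable a : nat.
Hypotheses (a6 : coprime a 6) (lt_a6 : a < 6).

Let a0 : 0 < a. Proof. by case: a a6. Qed.

Lemma chebyshev_quot_prod (n : nat) :
  chebyshev_quot a n = \prod_(0 <= p < 6 * n)
    (if prime p then p ^ logn p (chebyshev_quot a n) else 1).
Proof.
rewrite -big_mkcond; apply: prod_pfactor; first exact: chebyshev_quot_gt0.
move=> p pp np; have := logn_chebyshev_quot_le n a6 lt_a6 pp.
have [->|n0] := posnP n; first by rewrite muln0 trunc_log0 leqn0 => /eqP.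
(* The valuation bound alone would allow [p = 6 * n], which is not a prime. *)
have [e|ne] := eqVneq (6 * n) p.
  have /(coprime6 pp) : 3 < p by lia.
  by rewrite -e /coprime gcdnC gcdnMr.
have lt_np : 6 * n < p by lia.
case: (logn _ _) => // v hv; have := trunc_logP (prime_gt1 pp) (_ : 0 < 6 * n).
rewrite muln_gt0 n0 => /(_ isT); rewrite leqNgt => /negP[].
apply: leq_trans lt_np _; rewrite -{1}(expn1 p) leq_pexp2l ?(prime_gt0 pp) //.
by apply: leq_trans hv.
Qed.

(** The exponent of 3 in the factorial is at most half of [n]; squaring keeps the exponents
    integral, and [432 = 12 ^ 2 * 3]. *)
Lemma chebyshev_quot_sqr_le (n : nat) : chebyshev_quot a n ^ 2 <= 432 ^ n.
Proof.
have le_Q : chebyshev_quot a n <= 12 ^ n * 3 ^ logn 3 n`!.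
  rewrite -(leq_pmul2r (fact_gt0 n)) chebyshev_quotE //.
  apply: leq_trans (leq_mul (progression_prod_le n lt_a6) (leqnn _)) _.
  have : 2 ^ logn 2 n`! <= 2 ^ n by rewrite leq_exp2l // logn2_fact_le.
  rewrite (expnMn 6 2 n) => h; rewrite -!mulnA leq_mul2l; apply/orP; right.
  by rewrite mulnC -!mulnA leq_mul2r h orbT.
apply: (@leq_trans ((12 ^ n * 3 ^ logn 3 n`!) ^ 2)); first by rewrite leq_exp2r.
have -> : 432 ^ n = (12 ^ n) ^ 2 * 3 ^ n by rewrite -expnM (mulnC n) expnM -expnMn.
rewrite expnMn leq_mul2l -(expnM 3); apply/orP; right.
by rewrite leq_exp2l // muln2 logn3_fact_le.
Qed.

(** The factor [(6 * n) ^ 2] is the loss in [progression_prod_ge]; the losses on the powers of 2 and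
    3 are [n.+1 ^ 2] each after squaring. *)
Lemma chebyshev_quot_sqr_ge (n : nat) : 0 < n ->
  432 ^ n <= chebyshev_quot a n ^ 2 * ((6 * n) ^ 2 * n.+1 ^ 4).
Proof.
move=> n0.
have le_Q : 6 ^ n * (2 ^ logn 2 n`! * 3 ^ logn 3 n`!) <= chebyshev_quot a n * (6 * n).
  rewrite -(leq_pmul2r (fact_gt0 n)).
  have := leq_mul (progression_prod_ge a0 n0) (leqnn (2 ^ logn 2 n`! * 3 ^ logn 3 n`!)).
  move: (chebyshev_quotE n a6 lt_a6).
  move: (2 ^ _ * 3 ^ _) (chebyshev_quot a n) (progression_prod a n) => W Q A.
  move: (6 ^ n) (n`!) => x y e; have := congr1 (muln (6 * n)) e; lia.
have le2 := pow2_logn_fact n; have le3 := pow3_logn_fact n.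
have -> : 432 ^ n = (6 ^ n) ^ 2 * ((2 ^ n) ^ 2 * 3 ^ n).
  by rewrite -!expnM !(mulnC n 2) !expnM -!expnMn.
have sq x y : x <= y -> x ^ 2 <= y ^ 2 by rewrite leq_exp2r.
apply: (@leq_trans ((6 ^ n) ^ 2 * ((2 ^ logn 2 n`! * n.+1) ^ 2 * (9 ^ logn 3 n`! * n.+1 ^ 2)))).
  by rewrite leq_mul2l; apply/orP; right; apply: leq_mul le3; apply: sq.
have := sq _ _ le_Q; rewrite !expnMn.
have -> : (3 ^ logn 3 n`!) ^ 2 = 9 ^ logn 3 n`! by rewrite -expnM mulnC expnM.
move=> h; have := leq_mul h (leqnn (n.+1 ^ 4)).
have -> : n.+1 ^ 4 = n.+1 ^ 2 * n.+1 ^ 2 by rewrite -expnD.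
move: (6 ^ n) (2 ^ logn 2 n`!) (9 ^ _) (n.+1 ^ 2) (chebyshev_quot a n) => x y z t u.
by rewrite -!mulnn; lia.
Qed.

(** Primes of the class up to [n] are in the first factor; those between [n] and [6 * n] divide the
    quotient. *)
Lemma class_primorial_le_mul (n N : nat) : N < 6 * n ->
  class_primorial a N <= class_primorial a n * chebyshev_quot a n.
Proof.
move=> Nn; rewrite (class_primorial_widen a Nn) chebyshev_quot_prod.
rewrite (@class_primorial_widen a n (6 * n)); last by lia.
rewrite -big_split /= big_nat_cond [leqRHS]big_nat_cond.
apply: leq_prod => p; rewrite andbT => /andP[_ pn].
have [pp|//] := boolP (prime p); have p0 := prime_gt0 pp.
have [/eqP pa|] := boolP (p %% 6 == a); last by rewrite muln_gt0 expn_gt0 p0.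
have [le_pn|lt_np] := leqP p n; rewrite /=; first by case: ifP; nia.
case: ifP => _; last by rewrite mul1n expn_gt0 p0.
by rewrite mul1n -{1}(expn1 p) leq_pexp2l // logn_chebyshev_quot_ge.
Qed.

(** A prime [p <= s] contributes a power of at most [6 * n]. A larger one occurs at most once, and
    lies in the class [a] or, in the opposite class, is at most a fifth of [6 * n]. *)
Lemma chebyshev_quot_le (n s : nat) : s < 6 * n < s.+1 ^ 2 ->
  chebyshev_quot a n <=
  (6 * n) ^ s * (class_primorial a (6 * n).-1 * class_primorial (6 - a) (6 * n %/ 5)).
Proof.
move=> /andP[sn ns].
have pow_s : \prod_(0 <= p < 6 * n) (if 0 < p <= s then 6 * n else 1) = (6 * n) ^ s.
  rewrite (big_cat_nat (n := s.+1) _ sn) //= [X in _ * X]big_nat_cond.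
  rewrite [X in _ * X]big1 ?muln1; last first.
    by move=> p; rewrite andbT => /andP[sp _]; rewrite (leqNgt p s) sp andbF.
  rewrite big_ltn // mul1n big_nat_cond.
  rewrite (eq_bigr (fun=> 6 * n)); last by move=> p; rewrite andbT ltnS => ->.
  by rewrite -big_nat_cond prod_nat_const_nat subSS subn0.
rewrite chebyshev_quot_prod -pow_s.
rewrite (@class_primorial_widen a _ (6 * n)); last by lia.
rewrite (@class_primorial_widen (6 - a) _ (6 * n)); last by lia.
rewrite -!big_split /= big_nat_cond [leqRHS]big_nat_cond.
apply: leq_prod => p; rewrite andbT => /andP[_ pn].
have n0 : 0 < 6 * n by lia.
set f1 := (if 0 < p <= s then _ else _).
set f2 := (if [&& _, _ & p <= _.-1] then _ else _).
set f3 := (if [&& _, _ & p <= _ %/ _] then _ else _).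
have g1 : 0 < f1 by rewrite /f1; case: ifP.
have g2 : 0 < f2 by rewrite /f2; case: ifP => // /andP[/prime_gt0].
have g3 : 0 < f3 by rewrite /f3; case: ifP => // /andP[/prime_gt0].
have g23 : 0 < f2 * f3 by rewrite muln_gt0 g2.
case: ifP => [pp|_]; last by rewrite !muln_gt0 g1 g2.
have [v0|v0] := posnP (logn p (chebyshev_quot a n)); first by rewrite v0 !muln_gt0 g1 g2.
have le_v := logn_chebyshev_quot_le n a6 lt_a6 pp.
have p1 := prime_gt1 pp; have p0 := prime_gt0 pp.
have [ps|sp] := leqP p s.
  apply: (@leq_trans (6 * n)).
    by apply: leq_trans (trunc_logP p1 n0); rewrite leq_pexp2l.
  by rewrite /f1 p0 ps leq_pmulr.
have v1 : logn p (chebyshev_quot a n) <= 1.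
  rewrite (leq_trans le_v) // -ltnS -(ltn_exp2l _ _ p1).
  apply: leq_ltn_trans (trunc_logP p1 n0) _; apply: leq_trans ns _.
  by rewrite leq_exp2r.
have -> : logn p (chebyshev_quot a n) = 1 by lia.
rewrite expn1 (leq_trans _ (leq_pmull _ g1)) //.
have [pa|pa] := eqVneq (p %% 6) a.
  by rewrite /f2 pp pa eqxx /= (_ : p <= (6 * n).-1) ?leq_pmulr //; lia.
have [np|np] := leqP (6 * n) (5 * p).
  by rewrite logn_chebyshev_quot_other in v0.
have p3 : 3 < p.
  by rewrite ltnNge; apply/negP => p3; rewrite logn_chebyshev_quot_small in v0.
have pb : p %% 6 = 6 - a.
  have := coprime6 pp p3; rewrite -coprime_modl.
  have : p %% 6 < 6 by rewrite ltn_mod.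
  move: pa; case: (p %% 6) => [|[|[|[|[|[|]]]]]] // ne _ _;
  by move: a6 lt_a6 ne; case: (a) => [|[|[|[|[|[|]]]]]].
by rewrite /f3 pp pb eqxx /= (_ : p <= 6 * n %/ 5) ?leq_pmull //; lia.
Qed.

(** Chebyshev's upper bound by strong induction: from [n], about [N / 6], to [N] the squared
    primorial grows by at most [432 ^ n], and [4 * 432 < 4 ^ 6]. *)
Lemma class_primorial_le (N : nat) : class_primorial a N ^ 2 <= 4 ^ (N + 60).
Proof.
have step n m : m < 6 * n -> class_primorial a m ^ 2 <= class_primorial a n ^ 2 * 432 ^ n.
  move=> mn; apply: leq_trans (_ : (class_primorial a n * chebyshev_quot a n) ^ 2 <= _).
    by rewrite leq_exp2r // class_primorial_le_mul.
  by rewrite expnMn leq_mul2l chebyshev_quot_sqr_le orbT.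
elim/ltn_ind: N => N IH; have [N60|N60] := ltnP N 60.
  have U2 : class_primorial a 2 = 1.
    rewrite /class_primorial big_nat_cond big1 // => p /andP[/andP[_ p3] /andP[pp pa]].
    by move: a6 pp; rewrite -(eqP pa); case: p p3 {pa} => [|[|[|]]].
  (* The base range is reached through the arguments 2, 10 and [N < 60], at the price
     [432 ^ 12 <= 2 ^ 108], which the constant 60 covers. *)
  have := step 2 10 isT; rewrite U2 mul1n => U10.
  have := step 10 N N60 => /leq_trans; apply.
  apply: leq_trans (leq_mul U10 (leqnn _)) _; rewrite -expnD.
  apply: (@leq_trans ((2 ^ 9) ^ 12)); first by rewrite leq_exp2r.
  by rewrite -expnM -[4]/(2 ^ 2) -expnM leq_exp2l //; lia.
set n := N %/ 6 + 1.
have nN : n < N by rewrite /n; lia.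
have Nn : N < 6 * n by rewrite /n; lia.
apply: leq_trans (step _ _ Nn) _.
apply: leq_trans (leq_mul (IH _ nN) (leqnn _)) _.
(* As [4 * 432 = 64 * 27], this is [27 ^ n * 2 ^ 12 <= 64 ^ n]. The spare [2 ^ 12] pays for the
   [+ 1] in [n = N %/ 6 + 1]. *)
have key : 4 ^ n * 432 ^ n * 2 ^ 12 <= 2 ^ (12 * n).
  have n11 : 10 <= n by rewrite /n; lia.
  have : 27 ^ n * 2 ^ 12 <= 2 ^ (6 * n).
    rewrite -(subnK n11); elim: (n - 10) => [|t IHt].
      rewrite add0n -(expnM 3 3); apply: (@leq_trans ((2 ^ 8) ^ 6 * 2 ^ 12)).
        by rewrite leq_mul2r (expnM 3 5 6) leq_exp2r // orbT.
      by rewrite -expnM -expnD leq_exp2l.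
    by rewrite !addSn expnS mulnS (expnD 2 6) -mulnA leq_mul.
  move=> h; rewrite -expnMn (expnMn 64 27) -mulnA.
  apply: leq_trans (leq_mul (leqnn _) h) _.
  by rewrite -[64]/(2 ^ 6) -expnM -expnD leq_exp2l //; lia.
rewrite -(leq_pmul2r (expn_gt0 2 12)) expnD mulnAC -mulnA mulnAC mulnC.
apply: (@leq_trans (2 ^ (12 * n) * 4 ^ 60)).
  move: key; move: (4 ^ n) (432 ^ n) (4 ^ 60) (2 ^ 12) (2 ^ (12 * n)) => x y z t u.
  by move=> h; have := leq_mul h (leqnn z); lia.
rewrite -[4]/(2 ^ 2) -!expnM -!expnD leq_exp2l //; rewrite /n; lia.
Qed.

End Bounds.

(** * Primes between 3n and 6n in a class modulo 6 *)

Lemma class_primorial_gap (a m n : nat) : m <= n ->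
  (forall p, prime p -> p %% 6 = a -> m < p -> n < p) ->
  class_primorial a n = class_primorial a m.
Proof.
move=> mn gap; rewrite /class_primorial (big_cat_nat (n := m.+1)) //=.
rewrite [X in _ * X]big_nat_cond [X in _ * X]big1 ?muln1 // => p.
by move=> /andP[/andP[mp pn] /andP[pp /eqP pa]]; have := gap p pp pa mp; lia.
Qed.

(** With [2 ^ L.-1 <= X] and [s ^ 2 <= X] this yields [18 * L * s <= X], which controls the small
    primes. It fails for [L = 17]. *)
Lemma square_lt_exp2 (L : nat) : 18 <= L -> (18 * L) ^ 2 <= 2 ^ L.-1.
Proof.
move=> L18; rewrite -(subnK L18); elim: (L - 18) => [|t IH].
  have -> : 2 ^ (0 + 18).-1 = 2 ^ 10 * 2 ^ 7 by rewrite -expnD.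
  by rewrite [2 ^ 10](_ : _ = 1024) // [2 ^ 7](_ : _ = 128).
have -> : (t.+1 + 18).-1 = (t + 18).-1.+1 by lia.
rewrite (expnS 2); apply: leq_trans (leq_mul (leqnn 2) IH).
by rewrite -!mulnn; nia.
Qed.

(** This is the rational lower bound 8.6 for the binary logarithm of 432. *)
Lemma exp432_ge : 2 ^ 43 <= 432 ^ 5.
Proof.
have -> : 432 ^ 5 = 2 ^ 20 * (243 * (243 * 243)).
  by rewrite -[243]/(3 ^ 5) -!expnD -[432]/(2 ^ 4 * 3 ^ 3) expnMn -!expnM.
have -> : 2 ^ 43 = 2 ^ 20 * (2 ^ 10 * 2 ^ 13) by rewrite -!expnD.
rewrite leq_mul2l; apply/orP; right.
have -> : 2 ^ 10 = 1024 by []. have -> : 2 ^ 13 = 64 * 128 by [].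
lia.
Qed.

(** Without such a prime the primorial up to [12 * k - 1] equals that up to [6 * k + 5], which is
    bounded through the quotient for [k + 1]. After cancelling [432 ^ k.+1] from [432 ^ (2 * k)], at
    least 8.6 k bits face about 6.8 k bits. *)
Lemma prime_in_class_large (a k : nat) : coprime a 6 -> a < 6 -> 1000 * 12 <= k ->
  exists2 p, prime p & (p %% 6 == a) && (6 * k + 6 <= p < 12 * k).
Proof.
move=> a6 lt_a6 k0.
have a0 : 0 < a by case: a a6 {lt_a6}.
have [/hasP[p]|/hasPn no] :=
    boolP (has (fun p => prime p && (p %% 6 == a)) (iota (6 * k + 6) (6 * k - 6))).
  rewrite mem_iota => /andP[p1 p2] /andP[pp pa]; exists p => //.
  by rewrite pa p1 /=; lia.
exfalso; have b6 : coprime (6 - a) 6.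
  by move: a6 lt_a6; case: a {no a0} => [|[|[|[|[|[|]]]]]].
have lt_b6 : 6 - a < 6 by lia.
pose s := PeanoNat.Nat.sqrt (12 * k).
have [ss sS] : s * s <= 12 * k /\ 12 * k < s.+1 * s.+1.
  by have := PeanoNat.Nat.sqrt_spec (12 * k) (PeanoNat.Nat.le_0_l _); rewrite -/s; lia.
have s_ok : s < 6 * (2 * k) < s.+1 ^ 2 by rewrite -mulnn; nia.
have U1 : class_primorial a (6 * (2 * k)).-1 = class_primorial a (6 * k + 5).
  apply: class_primorial_gap; first by lia.
  move=> p pp pa p1; rewrite ltnNge; apply/negP => p2.
  have /no : p \in iota (6 * k + 6) (6 * k - 6) by rewrite mem_iota; lia.
  by rewrite pp pa eqxx.
have := chebyshev_quot_le a6 lt_a6 s_ok; rewrite U1.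
have := @class_primorial_le_mul a a6 lt_a6 k.+1 (6 * k + 5) _.
have -> : 6 * k + 5 < 6 * k.+1 by lia.
move=> /(_ isT) U2 Q1.
have := leq_trans Q1 (leq_mul (leqnn _) (leq_mul U2 (leqnn _))).
rewrite -(leq_exp2r _ _ (isT : 0 < 2)) => Q2.
have := chebyshev_quot_sqr_ge a6 lt_a6 (_ : 0 < 2 * k); rewrite muln_gt0 /=.
have -> : 0 < k by lia.
move=> /(_ isT) low; have {Q2 low} := leq_trans low (leq_mul Q2 (leqnn _)).
set X := 6 * (2 * k); have XE : X = 6 * (2 * k) by [].
have X0 : 0 < X by clear -k0 XE; lia.
(* The left side is [2 ^ 17], which gives [L >= 18] below. *)
have X17 : 1024 * 128 <= X by clear -k0 XE; lia.
have kX : (2 * k).+1 <= X by clear -k0 XE; lia.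
have ssX : s ^ 2 <= X by rewrite -mulnn XE; clear -ss; lia.
have e3 : k.-1 + k.+1 = 2 * k by clear -k0; lia.
have s0 : 0 < s by clear -k0 sS; case: (s) sS => // h; lia.
have e4 : 0 < k.-1 by clear -k0; lia.
clearbody X; rewrite !expnMn => h1.
have Ua := class_primorial_le a6 lt_a6 k.+1.
have Ub := class_primorial_le b6 lt_b6 (X %/ 5).
have Qk := chebyshev_quot_sqr_le a6 lt_a6 k.+1.
have {h1 Ua Ub Qk} h2 : 432 ^ (2 * k) <=
  (X ^ s) ^ 2 * (4 ^ (k.+1 + 60) * 432 ^ k.+1 * 4 ^ (X %/ 5 + 60)) * (X ^ 2 * (2 * k).+1 ^ 4).
  apply: leq_trans h1 _; apply: leq_mul => //; apply: leq_mul => //.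
  by apply: leq_mul => //; apply: leq_mul.
pose L := (trunc_log 2 X).+1.
have XL : X < 2 ^ L by apply: trunc_log_ltn.
have LX : 2 ^ L.-1 <= X by apply: trunc_logP.
have L18 : 18 <= L.
  by rewrite ltnS; apply: trunc_log_max.
clearbody L s.
have e1 : (X ^ s) ^ 2 <= 2 ^ (2 * (L * s)).
  by rewrite (mulnC 2) expnM leq_exp2r // expnM leq_exp2r // ltnW.
have e2 : X ^ 2 * (2 * k).+1 ^ 4 <= 2 ^ (6 * L).
  apply: (@leq_trans (X ^ 6)).
    by rewrite (expnD X 2 4) leq_mul2l leq_exp2r // kX orbT.
  by rewrite mulnC expnM leq_exp2r // ltnW.
have h3 : 432 ^ k.-1 <= 2 ^ (2 * (L * s) + 2 * (k.+1 + 60 + (X %/ 5 + 60)) + 6 * L).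
  rewrite -(leq_pmul2r (expn_gt0 432 k.+1)) -expnD.
  rewrite e3.
  apply: leq_trans h2 _.
  apply: leq_trans (leq_mul (leq_mul e1 (leqnn _)) e2) _.
    have -> : 2 ^ (2 * (L * s) + 2 * (k.+1 + 60 + (X %/ 5 + 60)) + 6 * L) =
      2 ^ (2 * (L * s)) * (4 ^ (k.+1 + 60) * 4 ^ (X %/ 5 + 60)) * 2 ^ (6 * L).
    by rewrite -[4]/(2 ^ 2) -!expnM -!expnD; congr (2 ^ _); clear; lia.
  move: (2 ^ (2 * (L * s))) (2 ^ (6 * L)) (4 ^ (k.+1 + 60)) (4 ^ (X %/ 5 + 60)) (432 ^ k.+1).
  by clear=> x y z t u; lia.
have : 2 ^ (43 * k.-1) <=
    2 ^ ((2 * (L * s) + 2 * (k.+1 + 60 + (X %/ 5 + 60)) + 6 * L) * 5).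
  rewrite expnM; apply: (@leq_trans ((432 ^ 5) ^ k.-1)).
    by rewrite leq_exp2r ?exp432_ge.
  by rewrite -expnM mulnC expnM [leqRHS]expnM leq_exp2r.
rewrite leq_exp2l // {h2 h3 e1 e2} => h4.
have := leq_trans (square_lt_exp2 L18) LX => LX2.
have sL : 18 * L * s <= X.
  rewrite -(leq_exp2r _ _ (isT : 0 < 2)) expnMn -[leqRHS]mulnn.
  by apply: leq_mul.
have LX3 : 324 * L <= X.
  by apply: leq_trans LX2; rewrite -mulnn; nia.
(* Up to a constant the gap is 1.8 k bits, or 0.15 X; the remaining terms [2 * L * s <= X / 9] and
   [6 * L <= X / 54] do not fill it. *)
by lia.
Qed.

(* [check_cover a lo ps] says that every [n >= lo] up to a third of the last
   entry of [ps] satisfies [3 * n <= p <= 6 * n - 5] for some [p] in [ps]. *)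
Fixpoint check_cover (a lo : nat) (ps : seq nat) : bool :=
  if ps is p :: ps' then
    [&& prime p, p %% 6 == a, p + 5 <= 6 * lo & check_cover a (p %/ 3).+1 ps']
  else true.

Lemma check_coverP (a lo n : nat) (ps : seq nat) : check_cover a lo ps ->
  0 < lo <= n -> 3 * n <= last (3 * lo - 1) ps ->
  exists2 p, prime p & (p %% 6 == a) && (3 * n <= p <= 6 * n - 5).
Proof.
elim: ps lo => [|p ps IH] lo; first by move=> _ /andP[lo0 h1]; rewrite [last _ _]/= => h2; lia.
case/and4P => pp pa p_lo cov /andP[lo0 lo_n]; rewrite [last _ _]/= => le_last.
have [le_np|lt_pn] := leqP (3 * n) p.
  by exists p => //; rewrite pa le_np; lia.
apply: IH cov _ _; first by lia.
by case: ps le_last => [|q ps]; rewrite [last _ _]/= ?[last _ [:: _ & _]]/=; lia.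
Qed.

(** Beyond 24000, [k = n.-1 %/ 2] satisfies [3 * n <= 6 * k + 6] and [12 * k <= 6 * n - 6]. Up to
    there, a chain of primes, each about twice the previous one, covers all [n]. *)
Lemma prime_in_class (a n : nat) : coprime a 6 -> a < 6 -> 200 <= n ->
  exists2 p, prime p & (p %% 6 == a) && (3 * n <= p <= 6 * n - 5).
Proof.
move=> a6 lt_a6 n200; have [n_small|n_large] := leqP n (24 * 1000); last first.
  have [|p pp /andP[pa lp]] := @prime_in_class_large a (n.-1 %/ 2) a6 lt_a6.
    by lia.
  by exists p => //; rewrite pa; lia.
have [a1|a5] : a = 1 \/ a = 5.
  by case: a a6 lt_a6 => [|[|[|[|[|[|a]]]]]] //; [left | right].
- apply: (@check_coverP a 200 n
    [:: 1171; 2341; 4663; 93 * 100 + 19; 18 * 1000 + 637; 37 * 1000 + 273; 74 * 1000 + 527]) => //.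
    by rewrite a1; vm_compute.
  by rewrite [last _ _]/=; lia.
- apply: (@check_coverP a 200 n
    [:: 1193; 2381; 4751; 94 * 100 + 97; 18 * 1000 + 959; 37 * 1000 + 907; 75 * 1000 + 797]) => //.
    by rewrite a5; vm_compute.
  by rewrite [last _ _]/=; lia.
Qed.

(** * Collisions *)

(* The constant [c] is encoded by naturals as [c1 - c2], so that
   [e] stands for [d * (k + l) - c]. *)
Definition collision (d c1 c2 n m : nat) : Prop :=
  exists k l e, [/\ 0 < l < k, k <= n, e + c1 = d * (k + l) + c2
    & m %| 2 * radical d * (k - l) * e].

Lemma term_sub (d c1 c2 k l e : nat) : l < k -> e + c1 = d * (k + l) + c2 ->
  (term d (c1%:Z - c2%:Z) k - term d (c1%:Z - c2%:Z) l)%R =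
  Posz (2 * radical d * (k - l) * e).
Proof.
move=> lk he; rewrite /term; move: (radical d) => r.
have -> : Posz (2 * r * (k - l) * e) = (2 * r%:Z * (k%:Z - l%:Z) * e%:Z)%R.
  by rewrite !PoszM -subzn // ltnW.
have -> : (e%:Z = d%:Z * (k%:Z + l%:Z) - (c1%:Z - c2%:Z))%R.
  by rewrite -PoszD -PoszM; lia.
by ring.
Qed.

Lemma collision_neq (d c1 c2 n m : nat) (c : int) : c = (c1%:Z - c2%:Z)%R ->
  collision d c1 c2 n m -> ~~ distinct_mod d c n m.
Proof.
move=> -> [k [l [e [/andP[l0 lk] kn he dv]]]]; rewrite /distinct_mod negb_and.
apply/orP; right; apply/negP => un.
have := @nth_uniq _ 0%R _ l.-1 k.-1 _ _ un.
rewrite !size_map size_iota !(nth_map 0) ?size_iota ?nth_iota; [|lia..].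
have -> : 1 + l.-1 = l by lia.
have -> : 1 + k.-1 = k by lia.
have -> : ((term d (c1%:Z - c2%:Z) l %% m)%Z == (term d (c1%:Z - c2%:Z) k %% m)%Z).
  by rewrite eq_sym eqz_mod_dvd (term_sub lk he) dvdzE.
by move=> h; have := h _ _; lia.
Qed.

Lemma collision_of_neq (d c1 c2 n m : nat) (c : int) : c = (c1%:Z - c2%:Z)%R ->
  0 < m -> c1 < d -> ~ collision d c1 c2 n m -> distinct_mod d c n m.
Proof.
move=> -> m0 c1d no; rewrite /distinct_mod m0 /=.
have sep k l : 0 < l < k -> k <= n ->
  (term d (c1%:Z - c2%:Z) k %% m)%Z != (term d (c1%:Z - c2%:Z) l %% m)%Z.
  move=> /andP[l0 lk] kn; apply/negP; rewrite eqz_mod_dvd.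
  have he : (d * (k + l) + c2 - c1) + c1 = d * (k + l) + c2.
    by rewrite subnK // (leq_trans (ltnW c1d)) //; nia.
  rewrite (term_sub lk he) dvdzE => dv; apply: no.
  by exists k, l, (d * (k + l) + c2 - c1); rewrite l0.
rewrite map_inj_in_uniq ?iota_uniq // => i j.
rewrite !mem_iota => hi hj e; case: (ltngtP i j) => // ij.
- by have := sep j i; rewrite e eqxx => h; suff: false by []; apply: h; lia.
- by have := sep i j; rewrite e eqxx => h; suff: false by []; apply: h; lia.
Qed.

(** The second hypothesis, applied to the least modulus, gives an [a] below it; by the first, [a]
    also separates the terms, so the two are equal. *)
Lemma least_modulus_isleast (d : nat) (c : int) (dc : (- d%:Z < c < d%:Z)%R) (n B : nat) :
  (forall a, B <= a -> in_S d c a -> distinct_mod d c n a) ->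
  (forall m, distinct_mod d c n m -> exists2 a, a <= m & B <= a /\ in_S d c a) ->
  is_least (fun a => B <= a /\ in_S d c a) (least_modulus dc n).
Proof.
move=> inS_distinct distinct_inS; rewrite /least_modulus.
case: ex_minnP => m0 dm0 min_m0; split.
  have [a am [Ba Sa]] := distinct_inS _ dm0.
  by have -> : m0 = a by apply/eqP; rewrite eqn_leq am min_m0 ?inS_distinct.
by move=> b [Bb Sb]; rewrite min_m0 ?inS_distinct.
Qed.

(** The pair is encoded by [s = k + l] and [t = k - l], of equal parity; [s + t <= 2 * n] is
    [k <= n]. *)
Lemma collision_sum_diff (d c1 c2 n m s t e : nat) :
  0 < t < s -> s + t <= 2 * n -> odd (s + t) = false -> e + c1 = d * s + c2 ->
  m %| 2 * radical d * t * e -> collision d c1 c2 n m.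
Proof.
move=> ts st odd_st he dv; exists ((s + t)./2), ((s - t)./2), e.
have e1 : (s + t)./2 + (s - t)./2 = s by lia.
have e2 : (s + t)./2 - (s - t)./2 = t by lia.
by rewrite e1 e2; split => //; lia.
Qed.

Lemma radical2 : radical 2 = 2.
Proof. by rewrite /radical (_ : primes 2 = [:: 2]) // big_seq1. Qed.

Lemma radical3 : radical 3 = 3.
Proof. by rewrite /radical (_ : primes 3 = [:: 3]) // big_seq1. Qed.

Lemma collision_small (d c1 c2 n m : nat) : c1 < d -> 0 < m < n ->
  collision d c1 c2 n m.
Proof.
(* The pair is [l = 1], [k = m + 1]. *)
move=> c1d mn; apply: (@collision_sum_diff _ _ _ _ _ (m + 2) m (d * (m + 2) + c2 - c1)); [lia..| |].
  by rewrite subnK // (leq_trans (ltnW c1d)) //; nia.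
by rewrite -!mulnA dvdn_mull // dvdn_mull // dvdn_mulr.
Qed.

(** * Elements of S beyond the bound have no collision *)

Lemma distinct_prod_dvd (a b p : nat) : prime p -> 0 < a < p -> 0 < b < p -> ~~ (p %| a * b).
Proof.
by move=> pp /andP[a0 ap] /andP[b0 bp]; rewrite Euclid_dvdM // !gtnNdvd.
Qed.

(** An odd prime [a] exceeds both [k - l] and [e <= 4 * n - 2 + c2 - c1]. A power of 2 is coprime to
    the odd [e], so it would divide [4 * (k - l) <= 4 * n - 4]. *)
Lemma in_S2_no_collision (c1 c2 n B a : nat) : c1 + c2 = 1 ->
  4 * n - 1 <= B -> 4 * n - 2 + c2 < B + c1 -> B <= a ->
  (prime a /\ odd a) \/ (exists j, a = 2 ^ j) -> ~ collision 2 c1 c2 n a.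
Proof.
move=> c12 B1 B2 Ba Sa [k [l [e [kl kn he]]]]; rewrite radical2 => dv.
case: Sa => [[pa oa]|[j ja]].
  have a2 : coprime a 2 by rewrite coprimen2.
  move: dv; rewrite -mulnA Gauss_dvdr; last by rewrite coprimeMr a2.
  by apply/negP; apply: distinct_prod_dvd => //; lia.
have oe : odd e by lia.
move: dv; rewrite Gauss_dvdl; last by rewrite ja coprimeXl // coprime2n.
by move=> /dvdn_leq; lia.
Qed.

(** As [e < 2 * a], a prime [a] divides [e] only if [e = a], but modulo 3 [a] is [c] and [e] is
    [- c]. A power of 3 is coprime to [e], so it would divide [3 * (k - l) <= 3 * n - 3]. *)
Lemma in_S3_no_collision (c1 c2 n B a : nat) : 0 < c1 + c2 <= 2 -> c1 * c2 = 0 ->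
  2 < n -> 3 * n - 1 <= B -> 6 * n - 3 + c2 < 2 * B + c1 -> B <= a ->
  (prime a /\ a + c2 = c1 %[mod 3]) \/ (exists j, a = 3 ^ j) ->
  ~ collision 3 c1 c2 n a.
Proof.
move=> c12 c0 n2 B1 B2 Ba Sa [k [l [e [kl kn he]]]]; rewrite radical3 => dv.
case: Sa => [[pa ma]|[j ja]].
  have /coprime6 a6 := pa.
  move: dv; rewrite -mulnA Gauss_dvdr; last by apply: a6; lia.
  rewrite Euclid_dvdM // gtnNdvd /=; [|lia..].
  move=> /dvdnP[h eh]; have h2 : h < 2.
    rewrite ltnNge; apply/negP => h2.
    have : 2 * a <= e by rewrite eh leq_mul2r h2 orbT.
    by lia.
  have a0 := prime_gt0 pa.
  case: h h2 eh => [|[|//]] _ eh; first by lia.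
  by case: c1 c2 c12 c0 he ma {B2} => [|[|[|?]]] [|[|[|?]]]; lia.
have e3 : ~~ (3 %| e) by case: c1 c2 c12 c0 he {B2} => [|[|[|?]]] [|[|[|?]]]; lia.
move: dv; rewrite Gauss_dvdl; last by rewrite ja coprimeXl // prime_coprime.
case: j ja => [|j] ja; first by rewrite ja in Ba; lia.
rewrite ja expnS -(mulnA 2) mulnCA dvdn_pmul2l //.
rewrite Gauss_dvdr ?coprimeXl // => /dvdn_leq.
by rewrite ja expnS in Ba; lia.
Qed.

(** * Collisions for d = 2 *)

Lemma pos_dvd_affine (q k r : nat) : 0 < q -> coprime q k ->
  exists2 x, 0 < x <= q & q %| k * x + r.
Proof.
move=> q0 qk; have [x xq dx] := dvd_affine (k + r) q0 qk.
by exists x.+1; rewrite ?xq // mulnS (addnC k) -addnA.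
Qed.

Lemma collision2_sum (c1 c2 n m b : nat) : c1 + c2 = 1 -> odd b -> 50 <= b ->
  b + c1 <= 4 * n - 2 + c2 -> m %| 4 * b -> collision 2 c1 c2 n m.
Proof.
move=> c12 ob b50 bn dv; have [s sE] : exists s, b + c1 = 2 * s + c2.
  by exists ((b + c1 - c2)./2); lia.
pose t := if odd s then 1 else 2.
apply: (@collision_sum_diff _ _ _ _ _ s t b) => //; rewrite /t; [case: ifP; lia..|].
by rewrite radical2 mulnAC dvdn_mulr.
Qed.

(** With [t = g] and [s = 2 * x + g], [b] has to divide [4 * x + 2 * g - c], which is solvable with
    [0 < x <= b] as [b] is odd. *)
Lemma collision2_diff (c1 c2 n m b g : nat) : c1 + c2 = 1 -> odd b -> 0 < g ->
  b + g <= n -> m %| 4 * g * b -> collision 2 c1 c2 n m.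
Proof.
move=> c12 ob g0 bgn dv; have b0 : 0 < b by case: b ob {bgn dv}.
have [|x x0 /dvdnP[q qE]] := @pos_dvd_affine b 4 (2 * g + c2 - c1) b0.
  by rewrite -[4]/(2 ^ 2) coprimeXr // coprimen2.
apply: (@collision_sum_diff _ _ _ _ _ (2 * x + g) g (q * b)); [lia..| |].
  by rewrite -qE; lia.
by rewrite radical2 mulnCA dvdn_mull // mulnA.
Qed.

(** If [b <= 2 * g + 1], then [b + g <= n]. Otherwise [t = g] requires an even [s]: passing from
    [e = b] to [e = 3 * b] shifts [s] by the odd [b]. *)
Lemma collision2_even (c1 c2 n m b g : nat) : c1 + c2 = 1 -> 200 <= n -> odd b ->
  2 < b -> ~~ odd g -> 0 < g -> g * b < 2 * n -> m %| 4 * g * b ->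
  collision 2 c1 c2 n m.
Proof.
move=> c12 n200 ob b2 eg g0 gb dv; have g2 : 2 <= g by lia.
have [bg|gb1] := leqP b (2 * g + 1).
  apply: (@collision2_diff c1 c2 n m b g) => //.
  have [b20|b20] := leqP b 20; last by nia.
  have : 3 * g < 2 * n by nia.
  by lia.
have bn : b < n by nia.
have [s [e [es eb sb [le1 le2]]]] : exists s e, [/\ odd s = false, e + c1 = 2 * s + c2,
    b %| e & b <= 2 * s + 1 /\ 2 * s <= 3 * b + 1].
  have [ev|od] := boolP (odd ((b + c1 - c2)./2)).
    by exists ((3 * b + c1 - c2)./2), (3 * b); split; rewrite ?dvdn_mull //; lia.
  by exists ((b + c1 - c2)./2), b; split=> //; lia.
apply: (@collision_sum_diff _ _ _ _ _ s g e) => //; [lia..|].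
by rewrite radical2 (dvdn_trans dv) // dvdn_mul.
Qed.

(** If [b <= 4 * g + 1], the bound on [m] forces [b + g <= n]. Otherwise [e = b], and [t] is [g] or
    [2 * g], whichever has the parity of [s]. *)
Lemma collision2_odd (c1 c2 n m b g : nat) : c1 + c2 = 1 -> 200 <= n -> odd b ->
  odd g -> 3 <= g <= b -> m = g * b -> m <= 8 * n - 3 ->
  collision 2 c1 c2 n m.
Proof.
move=> c12 n200 ob og /andP[g3 gb] -> mn.
have [bg|gb1] := leqP b (4 * g + 1).
  apply: (@collision2_diff c1 c2 n _ b g) => //; [lia| |by rewrite -mulnA dvdn_mull].
  rewrite leqNgt; apply/negP => bgn.
  have g1 : n <= 5 * g + 1 by lia.
  have b1 : n < 2 * b by lia.
  by nia.
have [s sE] : exists s, b + c1 = 2 * s + c2.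
  by exists ((b + c1 - c2)./2); lia.
have sg : s + 2 * g <= 2 * n.
  have [g4|g4] := leqP g 4; last first.
    have : 5 * b <= 8 * n by nia.
    by lia.
  have : 3 * b <= 8 * n by nia.
  have -> : g = 3 by lia.
  by lia.
pose t := if odd s then g else 2 * g.
apply: (@collision_sum_diff _ _ _ _ _ s t b) => //; rewrite /t; [case: ifP; lia..|].
by rewrite dvdn_mul // dvdn_mull //; case: ifP => _; rewrite ?dvdn_mull.
Qed.

Lemma composite_factors (m : nat) : 1 < m -> ~~ prime m ->
  exists g b, 1 < g <= b /\ m = g * b.
Proof.
move=> m1 /primePn[|[d /andP[d1 dm] /dvdnP[q mE]]]; first by lia.
have q1 : 1 < q by case: q mE => [|[|q]]; lia.
by case: (leqP d q) => [dq|/ltnW qd]; [exists d, q | exists q, d];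
  rewrite ?d1 ?q1 //; split=> //; rewrite mulnC.
Qed.

(** The power of 2 in [[4 * n, 8 * n - 2]] settles all [m] but those up to [8 * n - 3]. For these,
    [m = b * 2 ^ E] is split into [b = 1], [E >= 3], [E] equal to 1 or 2, and [m] odd. *)
Lemma in_S2_le (c1 c2 n B m : nat) : c1 + c2 = 1 -> 200 <= n -> B = 4 * n - c1 ->
  ~ collision 2 c1 c2 n m -> 0 < m ->
  exists2 a, a <= m & B <= a /\ ((prime a /\ odd a) \/ exists j, a = 2 ^ j).
Proof.
move=> c12 n200 BE noc m0.
have mn : n <= m.
  by rewrite leqNgt; apply/negP => mn; apply: noc; apply: collision_small; lia.
pose P := 2 ^ up_log 2 (4 * n).
have P1 : 4 * n <= P by apply: up_logP.
have P2 : P <= 8 * n - 2.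
  have n1 : 1 < 4 * n by lia.
  have := up_log_gtn (isT : 1 < 2) n1; rewrite /P; case: (up_log 2 (4 * n)) => [|j]; first by lia.
  by rewrite expnS /=; lia.
have [Pm|mP] := leqP P m.
  by exists P => //; split; [lia | right; exists (up_log 2 (4 * n))].
have [b ob mE] : exists2 b, odd b & m = b * 2 ^ logn 2 m.
  by have [b] := pfactor_coprime (isT : prime 2) m0; rewrite coprime2n; exists b.
set E := logn 2 m in mE.
have [bE|b2] := leqP b 2.
  have b1 : b = 1 by case: b ob bE {mE} => [|[|[|]]].
  rewrite b1 mul1n in mE.
  have [Bm|mB] := leqP B m; first by exists m => //; split=> //; right; exists E.
  exfalso; apply: noc; have [j Ej] : exists j, E = j.+2.
    by case: (E) mE => [|[|j]] mE; [lia | lia | exists j].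
  rewrite Ej !expnS in mE.
  (* Here [l = 1] and [k = 2 ^ j + 1], since [m = 4 * 2 ^ j] divides [4 * (k - l)]. *)
  apply: (@collision_sum_diff _ _ _ _ _ (2 ^ j + 2) (2 ^ j)
    (2 * (2 ^ j + 2) + c2 - c1)) => //;
    [lia..|].
  by rewrite radical2 mE mulnA dvdn_mulr.
have [oE|E1] := leqP E 2; last first.
  exfalso; apply: noc; have [j Ej] : exists j, E = j.+3.
    by case: (E) E1 => [|[|[|j]]] //; exists j.
  rewrite Ej !expnS in mE.
  apply: (@collision2_even c1 c2 n m b (2 ^ j.+1)) => //.
  - by rewrite expnS mul2n odd_double.
  - by rewrite expn_gt0.
  - by rewrite expnS; lia.
  - by rewrite mE expnS; apply/dvdnP; exists 1; lia.
have m4b : m %| 4 * b.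
  by rewrite mE mulnC dvdn_mul // -[4]/(2 ^ 2) dvdn_exp2l.
have b50 : 50 <= b by have := dvdn_leq _ m4b; lia.
have [E0|E0] := posnP E; last first.
  exfalso; apply: noc; apply: (@collision2_sum c1 c2 n m b) => //.
  by case: (E) E0 mE => // j _; rewrite expnS; have := expn_gt0 2 j; nia.
rewrite E0 muln1 in mE.
have [Bm|mB] := leqP B m; last first.
  by exfalso; apply: noc; apply: (@collision2_sum c1 c2 n m b) => //; lia.
have [pm|npm] := boolP (prime m).
  by exists m => //; split=> //; left; rewrite {2}mE.
exfalso; apply: noc; have [|g [b' [gb' mE']]] := composite_factors _ npm; first by lia.
have : odd (g * b') by rewrite -mE' mE.
rewrite oddM => /andP[og ob'].
apply: (@collision2_odd c1 c2 n m b' g) => //; last by lia.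
by case: g og gb' {mE'} => [|[|[|]]].
Qed.

(** * Collisions for d = 3 *)

Lemma collision3_sum (c1 c2 n m s e : nat) : 
  2 < s <= 2 * n - 1 -> e + c1 = 3 * s + c2 -> m %| 6 * e -> collision 3 c1 c2 n m.
Proof.
move=> sn es dv; pose t := if odd s then 1 else 2.
apply: (@collision_sum_diff _ _ _ _ _ s t e) => //; rewrite /t; [case: ifP; lia..|].
by rewrite radical3 mulnAC dvdn_mulr.
Qed.

(** For small [b], [t] is [g] or [2 * g] with [3 * t - c = 2 * r] even; for [s = 2 * x + t] then
    [e = 2 * (3 * x + r)], and [b %| 3 * x + r] is solvable since [b] is coprime to 3. For large
    [b], [e] is [b] or [2 * b], whichever is [- c] modulo 3. *)
Lemma collision3_mul (c1 c2 n m b g : nat) : 0 < c1 + c2 <= 2 -> c1 * c2 = 0 ->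
  coprime b 3 -> odd g -> 0 < b -> (6 * g + 2 < b -> 2 * b + 2 + 6 * g <= 6 * n) ->
  (b <= 6 * g + 2 -> b + 2 * g <= n) -> m %| 6 * g * b -> collision 3 c1 c2 n m.
Proof.
move=> c12 c0 b3 og b0 large small dv.
have [bg|gb] := leqP b (6 * g + 2).
  pose t := if odd (c1 + c2) then g else 2 * g.
  have t_ok : g <= t <= 2 * g by rewrite /t; case: ifP; lia.
  have {}small := small bg.
  have [r rE] : exists r, 3 * t + c2 = c1 + 2 * r.
    exists ((3 * t + c2 - c1)./2); rewrite /t.
    by case: c1 c2 c12 c0 {t t_ok} => [|[|[|?]]] [|[|[|?]]] //=; lia.
  have [x x0 /dvdnP[q qE]] := pos_dvd_affine r b0 b3.
  apply: (@collision_sum_diff _ _ _ _ _ (2 * x + t) t (2 * (q * b))); [lia..| |].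
    by rewrite -qE; lia.
  have gt : g %| t by rewrite /t; case: ifP => _; rewrite ?dvdn_mull.
  rewrite radical3 (dvdn_trans dv) // (_ : _ * (2 * (q * b)) = 6 * t * b * (2 * q)); last by lia.
  by rewrite dvdn_mulr // !dvdn_mul.
have {}large := large gb.
have [s [e [es eb sb1 sb2]]] : exists s e, [/\ e + c1 = 3 * s + c2, b %| e,
    b <= 3 * s + 2 & 3 * s <= 2 * b + 2].
  have : ~~ (3 %| b) by rewrite -prime_coprime // coprime_sym.
  have [m1|m1] := eqVneq ((b + c1) %% 3) (c2 %% 3).
    move=> _; exists ((b + c1 - c2) %/ 3), b; split=> //; lia.
  move=> b3'; exists ((2 * b + c1 - c2) %/ 3), (2 * b); rewrite dvdn_mull //.
  case: c1 c2 c12 c0 m1 {large small} => [|[|[|?]]] [|[|[|?]]] //= _ _ m1; split=> //; lia.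
pose t := if odd (s + g) then 2 * g else g.
apply: (@collision_sum_diff _ _ _ _ _ s t e) => //; rewrite /t; [case: ifP; lia..|].
rewrite radical3 (dvdn_trans dv) // dvdn_mul // dvdn_mul //.
by case: ifP => _; rewrite ?dvdn_mull.
Qed.

(** A prime of the class up to [6 * n - 5] settles all [m] but those up to [6 * n - 6]. Multiples of
    3 come first, then even [m], then odd [m]. The hypothesis on [x < B] says that [e = 2 * x] keeps
    [k + l <= 2 * n - 1]. *)
Lemma in_S3_le (c1 c2 a n B m : nat) : 0 < c1 + c2 <= 2 -> c1 * c2 = 0 ->
  coprime a 6 -> a < 6 -> a + c2 = c1 %[mod 3] -> 200 <= n -> B <= 3 * n ->
  (forall x, x < B -> x + c2 = c1 %[mod 3] -> 2 * x + c1 <= 6 * n - 3 + c2) ->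
  ~ collision 3 c1 c2 n m -> 0 < m ->
  exists2 x, x <= m &
    B <= x /\ ((prime x /\ x + c2 = c1 %[mod 3]) \/ exists j, x = 3 ^ j).
Proof.
move=> c12 c0 a6 lt_a6 ac n200 B3 below noc m0.
have mn : n <= m.
  by rewrite leqNgt; apply/negP => mn; apply: noc; apply: collision_small; lia.
have [p pp /andP[/eqP pa pn]] := prime_in_class a6 lt_a6 n200.
have [pm|mp] := leqP p m.
  by exists p => //; split; [lia | left; split=> //; lia].
have {mp} mn2 : m <= 6 * n - 6 by lia.
have [b b3 mE] : exists2 b, coprime b 3 & m = b * 3 ^ logn 3 m.
  by have [b] := pfactor_coprime (isT : prime 3) m0; rewrite coprime_sym; exists b.
have b0 : 0 < b by case: (b) mE m0 => // ->; rewrite mul0n.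
case: (logn 3 m) mE => [|j] mE; last first.
  have g0 : 0 < 3 ^ j by rewrite expn_gt0.
  have og : odd (3 ^ j) by rewrite oddX orbT.
  rewrite expnS in mE.
  have e0 s : 0 < s -> exists e, e + c1 = 3 * s + c2.
    by exists (3 * s + c2 - c1); lia.
  have [b1|b1] := eqVneq b 1.
    have [Bm|mB] := leqP B m.
      by exists m => //; split=> //; right; exists j.+1; rewrite mE b1 mul1n expnS.
    exfalso; apply: noc; have [|e he] := e0 (3 ^ j + 2); first by lia.
    apply: (@collision_sum_diff _ _ _ _ _ (3 ^ j + 2) (3 ^ j) e) => //; [lia..|].
    by rewrite radical3 mE b1; apply/dvdnP; exists (2 * e); lia.
  exfalso; apply: noc.
  (* Now [k = 3 ^ j + 1], which is at most [n] exactly because [m = 6 * 3 ^ j <= 6 * n - 6]. *)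
  have [b2|b2] := eqVneq b 2.
    have [|e he] := e0 (3 ^ j + 2); first by lia.
    apply: (@collision_sum_diff _ _ _ _ _ (3 ^ j + 2) (3 ^ j) e) => //; [lia..|].
    by rewrite radical3 mE b2; apply/dvdnP; exists e; lia.
  have [b4|b4] := eqVneq b 4.
    have [|e he] := e0 (2 * 3 ^ j + 2); first by lia.
    apply: (@collision_sum_diff _ _ _ _ _ (2 * 3 ^ j + 2) (2 * 3 ^ j) e) => //; [lia..|].
    by rewrite radical3 mE b4; apply/dvdnP; exists e; lia.
  have b5 : 5 <= b by move: b3 b0 b1 b2 b4; case: (b) => [|[|[|[|[|]]]]].
  have gb : 3 ^ j * b <= 2 * n - 2 by lia.
  apply: (@collision3_mul c1 c2 n m b (3 ^ j)) => //; last first.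
  - by rewrite mE; apply/dvdnP; exists 2; lia.
  - move=> bg; have [b40|b40] := leqP b 40.
      have : 5 * 3 ^ j <= 2 * n by nia.
      by lia.
    have : 40 * 3 ^ j <= 2 * n by nia.
    by lia.
  - move=> bg; case: j {mE e0} g0 og gb bg => [|j] g0 og gb bg; first by lia.
    have g3 : 3 <= 3 ^ j.+1 by rewrite expnS; have := expn_gt0 3 j; lia.
    have : 3 * b <= 2 * n by nia.
    by lia.
rewrite expn0 muln1 in mE; rewrite -{}mE {b0} in b3.
have m3 : ~~ (3 %| m) by rewrite -prime_coprime // coprime_sym.
have sum s e : 2 < s <= 2 * n - 1 -> e + c1 = 3 * s + c2 -> m %| 6 * e -> False.
  by move=> s2 he dv; apply: noc; exact: (collision3_sum s2 he dv).
have [om|em] := boolP (odd m); last first.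
  exfalso; have [h hE] : exists h, m = 2 * h by exists m./2; lia.
  have [m1|m1] := eqVneq ((h + c1) %% 3) (c2 %% 3).
    apply: (sum ((h + c1 - c2) %/ 3) h); [lia|lia|].
    by rewrite hE; apply/dvdnP; exists 3; lia.
  (* As [h] is neither 0 nor [- c] modulo 3, it is [c], and [m = 2 * h] is [- c]. *)
  have hm : (m + c1) %% 3 = c2 %% 3.
    by case: c1 c2 c12 c0 m1 {below noc ac sum} => [|[|[|?]]] [|[|[|?]]] //; lia.
  by apply: (sum ((m + c1 - c2) %/ 3) m); rewrite ?dvdn_mull //; lia.
have [mc|mc] := eqVneq ((m + c2) %% 3) (c1 %% 3); last first.
  have hm : (m + c1) %% 3 = c2 %% 3.
    by case: c1 c2 c12 c0 mc {below noc ac sum} => [|[|[|?]]] [|[|[|?]]] //; lia.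
  by exfalso; apply: (sum ((m + c1 - c2) %/ 3) m); rewrite ?dvdn_mull //; lia.
have [Bm|mB] := leqP B m; last first.
  exfalso; have := below m mB mc => le_m.
  have hm : (2 * m + c1) %% 3 = c2 %% 3.
    by case: c1 c2 c12 c0 mc {below noc ac sum le_m} => [|[|[|?]]] [|[|[|?]]] //; lia.
  apply: (sum ((2 * m + c1 - c2) %/ 3) (2 * m)); [lia|lia|].
  by rewrite mulnA dvdn_mull.
have [pm|npm] := boolP (prime m); first by exists m => //; split=> //; left.
exfalso; apply: noc; have [|g [b' [gb mE]]] := composite_factors _ npm; first by lia.
have : odd (g * b') by rewrite -mE.
rewrite oddM => /andP[og ob].
have : coprime (g * b') 3 by rewrite -mE.
rewrite coprimeMl => /andP[g3 bc].
have g5 : 5 <= g by case: (g) og g3 gb => [|[|[|[|[|]]]]].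
apply: (@collision3_mul c1 c2 n m b' g) => //; first by lia.
- move=> bg; have : 5 * b' <= g * b' by rewrite leq_mul2r g5 orbT.
  by lia.
- move=> bg; rewrite leqNgt; apply/negP => nbg.
  (* From [b' <= 6 * g + 2] and [b' + 2 * g > n] follows [n - 2 < 8 * g], so that
     [b' * (n - 2) <= 8 * m <= 48 * (n - 1)]. With both factors at most 48, [b' + 2 * g] cannot
     exceed [n]. *)
  have b49 : b' <= 48.
    rewrite leqNgt; apply/negP => b49.
    have : b' * (n - 2) <= b' * (8 * g) by rewrite leq_mul2l; lia.
    have : 49 * (n - 2) <= b' * (n - 2) by rewrite leq_mul2r b49 orbT.
    by lia.
  by lia.
- by rewrite mE -mulnA dvdn_mull.
Qed.

(** * Small n *)

Definition check_pair (r d c1 c2 m k l e : N) : bool :=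
  [&& (0 <? l)%num, (l <? k)%num, (e + c1 =? d * (k + l) + c2)%num &
    ((2 * r * (k - l) * e) mod m =? 0)%num].

(* With [k - l = t], a collision needs [d * (k + l) - c] to be a multiple of
   [q]; the multiples beyond [d * t] are tried, which makes [l] positive. *)
Definition try_pair (r d c1 c2 m t h : N) : option N :=
  let q := (m / N.gcd m (2 * r * t))%num in
  let e := (q * (d * t / q + h))%num in
  let s := ((e + c1 - c2) / d)%num in
  let k := ((s + t) / 2)%num in
  let l := ((s - t) / 2)%num in
  if check_pair r d c1 c2 m k l e then Some k else None.

(** A heuristic search, with twelve multiples for each difference [t]; every pair that it accepts
    has passed [check_pair]. *)
Fixpoint try_pairs (r d c1 c2 m : N) (bound : N -> bool) (fuel : nat) (t h : N) : bool :=
  if fuel is f.+1 then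
    if (if try_pair r d c1 c2 m t h is Some k then bound k else false) then true
    else if (h <? 12)%num then try_pairs r d c1 c2 m bound f t (h + 1)%num
    else try_pairs r d c1 c2 m bound f (t + 1)%num 1%num
  else false.

(* Success means that every [n >= n0] with [b * n - b' > a] has a collision modulo [m]. *)
Definition check_modulus (r d c1 c2 b b' : N) (n0 m a : nat) : bool :=
  let bound k := ((k <=? N.of_nat n0) || (b * (k - 1) <=? N.of_nat a + b'))%num in
  try_pairs r d c1 c2 (N.of_nat m) bound 4000 1 1.

Definition in_S2b (a : nat) : bool := (prime a && odd a) || (a == 2 ^ trunc_log 2 a).
Definition in_S3b (c1 c2 a : nat) : bool :=
  (prime a && ((a + c2) %% 3 == c1 %% 3)) || (a == 3 ^ trunc_log 3 a).

(** The argument [a] carries the largest element of the set met so far, the best candidate below the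
    current modulus. *)
Fixpoint check_range (inS : pred nat) (ok : nat -> nat -> bool) (fuel m a : nat) : bool :=
  if fuel is f.+1 then
    let a' := if inS m then m else a in ok m a' && check_range inS ok f m.+1 a'
  else true.

Lemma check_pair_collision (d c1 c2 n m : nat) (k l e : N) :
  check_pair (N.of_nat (radical d)) (N.of_nat d) (N.of_nat c1) (N.of_nat c2)
    (N.of_nat m) k l e ->
  N.to_nat k <= n -> collision d c1 c2 n m.
Proof.
case/and4P => /N.ltb_lt l0 /N.ltb_lt lk /N.eqb_eq he /N.eqb_eq.
move=> /N.Div0.mod_divides[q qE] kn.
exists (N.to_nat k), (N.to_nat l), (N.to_nat e); split=> //.
- by apply/andP; split; lia.
- by have := congr1 N.to_nat he; rewrite !N2Nat.inj_add N2Nat.inj_mul N2Nat.inj_add !Nat2N.id.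
- apply/dvdnP; exists (N.to_nat q); rewrite [RHS]mulnC; have := congr1 N.to_nat qE.
  by rewrite !N2Nat.inj_mul N2Nat.inj_sub !Nat2N.id.
Qed.

Lemma try_pairsP (r d c1 c2 m : N) (bound : N -> bool) (fuel : nat) (t h : N) :
  try_pairs r d c1 c2 m bound fuel t h ->
  exists k l e, check_pair r d c1 c2 m k l e /\ bound k.
Proof.
elim: fuel t h => // f IH t h; rewrite [try_pairs _ _ _ _ _ _ _ _ _]/=.
case: ifP => [|_]; last by case: ifP => _; apply: IH.
rewrite /try_pair; case: ifP => // ok bk _.
by do 3!eexists; split; [exact: ok|].
Qed.

Lemma check_rangeP (inS : pred nat) (ok : nat -> nat -> bool) (fuel m0 a0 m : nat) :
  check_range inS ok fuel m0 a0 -> inS a0 -> a0 <= m0 -> m0 <= m < m0 + fuel ->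
  exists2 a, inS a && (a <= m) & ok m a.
Proof.
elim: fuel m0 a0 => [|f IH] m0 a0 /=; first by lia.
case/andP; set a' := if _ then _ else _ => okm rg Sa am mm.
have Sa' : inS a' by rewrite /a'; case: ifP.
have am' : a' <= m0 by rewrite /a'; case: ifP.
have [->|ne] := eqVneq m m0; first by exists a'; rewrite ?Sa'.
by apply: IH rg Sa' _ _; [exact: leqW | lia].
Qed.

(** Without a collision, the pair found has [k > n], so [b * n] is at most [b * (k - 1)]. *)
Lemma check_modulusP (d c1 c2 b b' n0 n m a : nat) :
  check_modulus (N.of_nat (radical d)) (N.of_nat d) (N.of_nat c1) (N.of_nat c2)
    (N.of_nat b) (N.of_nat b') n0 m a ->
  n0 <= n -> ~ collision d c1 c2 n m -> b * n - b' <= a.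
Proof.
rewrite /check_modulus; move: 4000 => fuel /try_pairsP[k [l [e [ok bd]]]] n0n noc.
have nk : n < N.to_nat k.
  by rewrite ltnNge; apply/negP => kn; apply: noc; exact: check_pair_collision ok kn.
case/orP: bd => [/N.leb_le|/N.leb_le] bd; first by lia.
have : b * n <= b * (N.to_nat k - 1) by rewrite leq_mul2l; apply/orP; right; lia.
have : b * (N.to_nat k - 1) <= a + b'; last by lia.
have -> : b * (N.to_nat k - 1) = N.to_nat (N.of_nat b * (k - 1))%num.
  by rewrite N2Nat.inj_mul N2Nat.inj_sub Nat2N.id.
by lia.
Qed.

Lemma in_S2b_in (a : nat) : in_S2b a -> (prime a /\ odd a) \/ exists j, a = 2 ^ j.
Proof. by case/orP => [/andP|/eqP ->]; [left | right; exists (trunc_log 2 a)]. Qed.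

Lemma in_S3b_in (c1 c2 a : nat) : in_S3b c1 c2 a ->
  (prime a /\ a + c2 = c1 %[mod 3]) \/ exists j, a = 3 ^ j.
Proof.
by case/orP => [/andP[pa /eqP]|/eqP ->]; [left | right; exists (trunc_log 3 a)].
Qed.

(** From 1600 on, the power of 2 in [[4 * n, 8 * n]] is below [m] because [n < 200]; the computation
    covers the moduli from 1 to 1599. *)
Lemma in_S2_le_small (c1 c2 n0 n m : nat) :
  check_range in_S2b
    (check_modulus 2 2 (N.of_nat c1) (N.of_nat c2) 4 (N.of_nat c1) n0) 1599 1 1 ->
  0 < n -> n0 <= n < 200 -> ~ collision 2 c1 c2 n m -> 0 < m ->
  exists2 a, a <= m & 4 * n - c1 <= a /\ ((prime a /\ odd a) \/ exists j, a = 2 ^ j).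
Proof.
move=> rg n1 /andP[n0n n200] noc m0; have [m1600|m1600] := leqP 1600 m.
  pose P := 2 ^ up_log 2 (4 * n).
  have P1 : 4 * n <= P by apply: up_logP.
  have P2 : P <= 8 * n.
    have n4 : 1 < 4 * n by lia.
    have := up_log_gtn (isT : 1 < 2) n4; rewrite /P.
    by case: (up_log 2 (4 * n)) => [|j]; [lia | rewrite expnS /=; lia].
  by exists P; [lia | split; [lia | right; exists (up_log 2 (4 * n))]].
have [|a /andP[Sa am] ok] := @check_rangeP _ _ _ _ _ m rg isT isT; first by lia.
exists a => //; split; last exact: in_S2b_in.
by apply: check_modulusP n0n noc; rewrite radical2; exact: ok.
Qed.

(** From 1800 on, a power of 3 in [[3 * n, 9 * n]] is below [m]; the computation covers the rest. *)
Lemma in_S3_le_small (c1 c2 b' n0 n m : nat) :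
  check_range (in_S3b c1 c2)
    (check_modulus 3 3 (N.of_nat c1) (N.of_nat c2) 3 (N.of_nat b') n0) 1799 1 1 ->
  0 < n -> n0 <= n < 200 -> ~ collision 3 c1 c2 n m -> 0 < m ->
  exists2 a, a <= m & 3 * n - b' <= a /\
    ((prime a /\ a + c2 = c1 %[mod 3]) \/ exists j, a = 3 ^ j).
Proof.
move=> rg n1 /andP[n0n n200] noc m0; have [m1800|m1800] := leqP 1800 m.
  pose P := 3 ^ up_log 3 (3 * n).
  have P1 : 3 * n <= P by apply: up_logP.
  have P2 : P <= 9 * n.
    have n3 : 1 < 3 * n by lia.
    have := up_log_gtn (isT : 1 < 3) n3; rewrite /P.
    by case: (up_log 3 (3 * n)) => [|j]; [lia | rewrite expnS /=; lia].
  by exists P; [lia | split; [lia | right; exists (up_log 3 (3 * n))]].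
have [||a /andP[Sa am] ok] := @check_rangeP _ _ _ _ _ m rg _ isT; [by rewrite /in_S3b orbT|lia|].
exists a => //; split; last exact: in_S3b_in Sa.
by apply: check_modulusP n0n noc; rewrite radical3; exact: ok.
Qed.

(** * The least modulus *)

Lemma in_S2E (c1 c2 a : nat) (c : int) : c = (c1%:Z - c2%:Z)%R -> c1 + c2 = 1 ->
  in_S 2 c a <-> (prime a /\ odd a) \/ exists j, a = 2 ^ j.
Proof.
move=> -> c12; suff e : (a%:Z = c1%:Z - c2%:Z %[mod 2%:Z])%Z <-> odd a.
  by split=> -[[pa /e]|ex]; by [left | right].
by case: c1 c2 c12 => [|[|?]] [|[|?]] // _; split; lia.
Qed.

Lemma in_S3E (c1 c2 a : nat) (c : int) : c = (c1%:Z - c2%:Z)%R ->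
  in_S 3 c a <-> (prime a /\ a + c2 = c1 %[mod 3]) \/ exists j, a = 3 ^ j.
Proof.
move=> ->; suff e : (a%:Z = c1%:Z - c2%:Z %[mod 3%:Z])%Z <-> a + c2 = c1 %[mod 3].
  by split=> -[[pa /e]|ex]; by [left | right].
by split; lia.
Qed.

Lemma least_modulus2 (c1 c2 n0 : nat) (c : int) (dc : (- 2%:Z < c < 2%:Z)%R) (n : nat) :
  c = (c1%:Z - c2%:Z)%R -> c1 + c2 = 1 -> 0 < n0 ->
  check_range in_S2b
    (check_modulus 2 2 (N.of_nat c1) (N.of_nat c2) 4 (N.of_nat c1) n0) 1599 1 1 ->
  n0 <= n -> is_least (fun a => 4 * n - c1 <= a /\ in_S 2 c a) (least_modulus dc n).
Proof.
move=> cE c12 n00 rg n0n; apply: least_modulus_isleast.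
  move=> a Ba /(in_S2E a cE c12) Sa; apply: (collision_of_neq cE); [lia..|].
  by apply: (@in_S2_no_collision _ _ n (4 * n - c1)) Sa => //; lia.
move=> m dm; have m0 : 0 < m by case/andP: dm.
have noc : ~ collision 2 c1 c2 n m by move/(collision_neq cE); rewrite dm.
have [a am [Ba Sa]] : exists2 a, a <= m &
    4 * n - c1 <= a /\ ((prime a /\ odd a) \/ exists j, a = 2 ^ j).
  have [n200|n200] := leqP 200 n; first exact: (in_S2_le c12 n200 erefl noc m0).
  by apply: (in_S2_le_small rg) noc m0; lia.
by exists a => //; split=> //; apply/(in_S2E a cE c12).
Qed.

(** [a6] is the class modulo 6 of the odd numbers congruent to [c] modulo 3. The shift [b'] is 1
    only for [c = 2], where [3 * n - 1] lies in the class of [c] but [e = 2 * (3 * n - 1)] is out of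
    range. *)
Lemma least_modulus3 (c1 c2 a6 b' n0 : nat) (c : int) (dc : (- 3%:Z < c < 3%:Z)%R) (n : nat) :
  c = (c1%:Z - c2%:Z)%R -> 0 < c1 + c2 <= 2 -> c1 * c2 = 0 ->
  coprime a6 6 -> a6 < 6 -> a6 + c2 = c1 %[mod 3] -> b' = (c1 == 2) -> 2 < n0 ->
  check_range (in_S3b c1 c2)
    (check_modulus 3 3 (N.of_nat c1) (N.of_nat c2) 3 (N.of_nat b') n0) 1799 1 1 ->
  n0 <= n -> is_least (fun a => 3 * n - b' <= a /\ in_S 3 c a) (least_modulus dc n).
Proof.
move=> cE c12 c0 cop lt_a6 ac bE n00 rg n0n; apply: least_modulus_isleast.
  move=> a Ba /(in_S3E a cE) Sa; apply: (collision_of_neq cE); [lia..|].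
  by apply: (@in_S3_no_collision _ _ n (3 * n - b')) Sa => //; lia.
move=> m dm; have m0 : 0 < m by case/andP: dm.
have noc : ~ collision 3 c1 c2 n m by move/(collision_neq cE); rewrite dm.
have [a am [Ba Sa]] : exists2 a, a <= m & 3 * n - b' <= a /\
    ((prime a /\ a + c2 = c1 %[mod 3]) \/ exists j, a = 3 ^ j).
  have [n200|n200] := leqP 200 n; last by apply: (in_S3_le_small rg) noc m0; lia.
  apply: (in_S3_le c12 c0 cop lt_a6 ac n200 _ _ noc m0); first by lia.
  (* Below the bound, [x] congruent to [c] is at most [3 * n - 2], [3 * n - 1], [3 * n - 4],
     [3 * n - 2] for [c] equal to 1, -1, 2, -2. *)
  by case: c1 c2 c12 c0 bE {cE rg noc ac} => [|[|[|?]]] [|[|[|?]]] //= _ _ ->; lia.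
by exists a => //; split=> //; apply/(in_S3E a cE).
Qed.

Lemma check2_1_0 :
  check_range in_S2b
    (check_modulus 2 2 (N.of_nat 1) (N.of_nat 0) 4 (N.of_nat 1) 5) 1599 1 1.
Proof. by vm_compute. Qed.

Lemma check2_0_1 :
  check_range in_S2b
    (check_modulus 2 2 (N.of_nat 0) (N.of_nat 1) 4 (N.of_nat 0) 7) 1599 1 1.
Proof. by vm_compute. Qed.

Lemma check3_1_0 :
  check_range (in_S3b 1 0)
    (check_modulus 3 3 (N.of_nat 1) (N.of_nat 0) 3 (N.of_nat 0) 4) 1799 1 1.
Proof. by vm_compute. Qed.

Lemma check3_0_1 :
  check_range (in_S3b 0 1)
    (check_modulus 3 3 (N.of_nat 0) (N.of_nat 1) 3 (N.of_nat 0) 5) 1799 1 1.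
Proof. by vm_compute. Qed.

Lemma check3_2_0 :
  check_range (in_S3b 2 0)
    (check_modulus 3 3 (N.of_nat 2) (N.of_nat 0) 3 (N.of_nat 1) 3) 1799 1 1.
Proof. by vm_compute. Qed.

Lemma check3_0_2 :
  check_range (in_S3b 0 2)
    (check_modulus 3 3 (N.of_nat 0) (N.of_nat 2) 3 (N.of_nat 0) 8) 1799 1 1.
Proof. by vm_compute. Qed.

Theorem theorem1p2 :
  (forall n : nat, 5 <= n ->
     is_least (fun a => 4 * n - 1 <= a /\ in_S 2 1%R a) (@least_modulus 2 1%R isT n)) /\
  (forall n : nat, 7 <= n ->
     is_least (fun a => 4 * n <= a /\ in_S 2 (- 1)%R a) (@least_modulus 2 (- 1)%R isT n)) /\
  (forall n : nat, 4 <= n ->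
     is_least (fun a => 3 * n <= a /\ in_S 3 1%R a) (@least_modulus 3 1%R isT n)) /\
  (forall n : nat, 5 <= n ->
     is_least (fun a => 3 * n <= a /\ in_S 3 (- 1)%R a) (@least_modulus 3 (- 1)%R isT n)) /\
  (forall n : nat, 3 <= n ->
     is_least (fun a => 3 * n - 1 <= a /\ in_S 3 2%R a) (@least_modulus 3 2%R isT n)) /\
  (forall n : nat, 8 <= n ->
     is_least (fun a => 3 * n <= a /\ in_S 3 (- 2)%R a) (@least_modulus 3 (- 2)%R isT n)).
Proof.
split=> [n hn|].
  by exact: (least_modulus2 (c1 := 1) (c2 := 0) (n0 := 5) (c := 1%R)
    isT erefl erefl isT check2_1_0 hn).
split=> [n hn|].
  by have := least_modulus2 (c1 := 0) (c2 := 1) (n0 := 7) (c := (- 1)%R)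
    isT erefl erefl isT check2_0_1 hn; rewrite subn0.
split=> [n hn|].
  by have := least_modulus3 (c1 := 1) (c2 := 0) (a6 := 1) (n0 := 4) (c := 1%R)
    isT erefl isT erefl isT isT erefl erefl isT check3_1_0 hn; rewrite subn0.
split=> [n hn|].
  by have := least_modulus3 (c1 := 0) (c2 := 1) (a6 := 5) (n0 := 5) (c := (- 1)%R)
    isT erefl isT erefl isT isT erefl erefl isT check3_0_1 hn; rewrite subn0.
split=> [n hn|].
  by exact: (least_modulus3 (c1 := 2) (c2 := 0) (a6 := 5) (n0 := 3) (c := 2%R)
    isT erefl isT erefl isT isT erefl erefl isT check3_2_0 hn).
move=> n hn.
by have := least_modulus3 (c1 := 0) (c2 := 2) (a6 := 1) (n0 := 8) (c := (- 2)%R)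
  isT erefl isT erefl isT isT erefl erefl isT check3_0_2 hn; rewrite subn0.
Qed.
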